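(* Let $\rho_{AB}$ be a density operator on $\mathcal{H}_A\otimes\mathcal{H}_B$ (finite-dimensional). Let $\alpha>0$ and $\beta,\gamma\geq 1/2$ (all different from $1$) satisfy $$\frac{\alpha}{\alpha-1}=\frac{\beta}{\beta-1}+\frac{\gamma}{\gamma-1}.$$ If $(\alpha-1)(\beta-1)(\gamma-1)>0$, then $$I^\uparrow_\gamma(A;B)_\rho\geq H_\beta(B)_\rho-H^\downarrow_\alpha(B|A)_\rho\quad\text{and}\quad I^\downarrow_\gamma(A:B)_\rho\geq H_\beta(B)_\rho-H^\uparrow_\alpha(B|A)_\rho .$$ If instead $(\alpha-1)(\beta-1)(\gamma-1)<0$, then $$I^\uparrow_\gamma(A;B)_\rho\leq H_\beta(B)_\rho-H^\downarrow_\alpha(B|A)_\rho\quad\text{and}\quad I^\downarrow_\gamma(A:B)_\rho\leq H_\beta(B)_\rho-H^\uparrow_\alpha(B|A)_\rho .$$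
   Context: All Hilbert spaces are finite-dimensional, $\log$ is base 2, $\mathrm{id}$ denotes an identity operator, and $\rho_A,\rho_B$ are the marginals of $\rho_{AB}$. $\mathcal{D}(A)$ is the set of density operators on $\mathcal{H}_A$. For positive semidefinite $\rho,\sigma$ and $\alpha\in(0,1)\cup(1,\infty)$ the sandwiched Rényi divergence is $D_\alpha(\rho\|\sigma)=\frac{1}{\alpha-1}\log\mathrm{tr}\big[(\sigma^{\frac{1-\alpha}{2\alpha}}\rho\,\sigma^{\frac{1-\alpha}{2\alpha}})^\alpha\big]$ if the images of $\rho$ and $\sigma$ do not intersect only in $\{0\}$ and (the kernel of $\sigma$ is contained in the kernel of $\rho$, or $\alpha<1$), and $D_\alpha(\rho\|\sigma)=+\infty$ otherwise. Rényi entropy: $H_\beta(B)_\rho=\frac{1}{1-\beta}\log\mathrm{tr}(\rho_B^\beta)$. Conditional entropies: $H^\downarrow_\alpha(B|A)_\rho=-D_\alpha(\rho_{AB}\|\rho_A\otimes\mathrm{id}_B)$ and $H^\uparrow_\alpha(B|A)_\rho=-\inf_{\sigma_A\in\mathcal{D}(A)}D_\alpha(\rho_{AB}\|\sigma_A\otimes\mathrm{id}_B)$. Mutual informations: $I^\uparrow_\gamma(A;B)_\rho=\inf_{\sigma_B\in\mathcal{D}(B)}D_\gamma(\rho_{AB}\|\rho_A\otimes\sigma_B)$ and $I^\downarrow_\gamma(A:B)_\rho=\inf_{\sigma_A\in\mathcal{D}(A),\sigma_B\in\mathcal{D}(B)}D_\gamma(\rho_{AB}\|\sigma_A\otimes\sigma_B)$.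 *)

(* Defs.v *)
From HB Require Import structures.
From mathcomp Require Import all_boot all_order all_algebra.
From mathcomp Require Import complex mxtens.
From mathcomp Require Import boolp classical_sets reals ereal exp.

Set Implicit Arguments.
Unset Strict Implicit.
Unset Printing Implicit Defensive.

Import Order.TTheory GRing.Theory Num.Theory.
Local Open Scope ring_scope.
Local Open Scope classical_set_scope.

Section Quantum.
Variable R : realType.
Local Notation C := (R[i]).

Definition adjmx m n (A : 'M[C]_(m, n)) : 'M[C]_(n, m) := map_mx Num.conj (A^T).

Definition hermitian n (A : 'M[C]_n) : Prop := adjmx A = A.

Definition psdmx n (A : 'M[C]_n) : Prop :=
  hermitian A /\ forall v : 'cV[C]_n, 0 <= (adjmx v *m A *m v) 0 0.

Definition density n (A : 'M[C]_n) : Prop := psdmx A /\ \tr A = 1.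

(* functional calculus A^t for a PSD (normal) matrix, via the spectral
   decomposition A = U^-1 diag(lambda) U with U unitary; eigenvalue 0 is
   mapped to 0 `^ t (= 0 for t <> 0), i.e. negative powers are taken on the
   support. *)
Definition mpow n (A : 'M[C]_n) (t : R) : 'M[C]_n :=
  let U := spectralmx A in
  invmx U *m diag_mx (\row_i real_complex R ((complex.Re (spectral_diag A 0 i)) `^ t)) *m U.

Definition retr n (A : 'M[C]_n) : R := complex.Re (\tr A).

Definition log2e (x : R) : \bar R :=
  if 0 < x then (ln x / ln 2)%:E else -oo%E.

(* column space (image) of A is the row space of A^T; column kernel of A
   is the row kernel of A^T *)
Definition sandwiched n (alpha : R) (rho sigma : 'M[C]_n) : \bar R :=
  let s := (1 - alpha) / (2 * alpha) in
  if ((rho^T :&: sigma^T)%MS != 0) &&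
     ((kermx (sigma^T) <= kermx (rho^T))%MS || (alpha < 1))
  then (((alpha - 1)^-1)%:E *
        log2e (retr (mpow (mpow sigma s *m rho *m mpow sigma s) alpha)))%E
  else +oo%E.

Definition ptrB dA dB (rho : 'M[C]_(dA * dB)) : 'M[C]_dA :=
  \matrix_(i, k) \sum_(j < dB) rho (mxtens_index (i, j)) (mxtens_index (k, j)).
Definition ptrA dA dB (rho : 'M[C]_(dA * dB)) : 'M[C]_dB :=
  \matrix_(j, l) \sum_(i < dA) rho (mxtens_index (i, j)) (mxtens_index (i, l)).

Definition renyiH n (beta : R) (rhoB : 'M[C]_n) : \bar R :=
  (((1 - beta)^-1)%:E * log2e (retr (mpow rhoB beta)))%E.

Definition Hdown dA dB (alpha : R) (rho : 'M[C]_(dA * dB)) : \bar R :=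
  (- sandwiched alpha rho (ptrB rho *t (1%:M : 'M[C]_dB)))%E.

Definition Hup dA dB (alpha : R) (rho : 'M[C]_(dA * dB)) : \bar R :=
  (- ereal_inf [set sandwiched alpha rho (sA *t (1%:M : 'M[C]_dB))
               | sA in [set s : 'M[C]_dA | density s]])%E.

Definition Iup dA dB (gamma : R) (rho : 'M[C]_(dA * dB)) : \bar R :=
  ereal_inf [set sandwiched gamma rho (ptrB rho *t sB)
            | sB in [set s : 'M[C]_dB | density s]].

Definition Idown dA dB (gamma : R) (rho : 'M[C]_(dA * dB)) : \bar R :=
  ereal_inf [set sandwiched gamma rho (s.1 *t s.2)
            | s in [set s : 'M[C]_dA * 'M[C]_dB | density s.1 /\ density s.2]].

End Quantum.

(* Main.v *)
Require Import Defs.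
From HB Require Import structures.
From mathcomp Require Import all_boot all_order all_algebra.
From mathcomp Require Import complex mxtens.
From mathcomp Require Import boolp classical_sets reals ereal exp.
From mathcomp Require Import sequences.
From mathcomp Require Import ring lra.
Import Order.TTheory GRing.Theory Num.Theory.
Local Open Scope ring_scope.

Set Implicit Arguments.
Unset Strict Implicit.
Unset Printing Implicit Defensive.

(** Write [u], [v], [w] for [(x - 1) / x] with [x] = alpha, gamma, beta, so
    that [1/u = 1/v + 1/w], and [q_z A = (tr A^(1/(1-z)))^(1-z)].  With
    [rho = X X^*], passing from [S rho S] to [X^* S^2 X] turns
    [D_gamma(rho || sA (x) sB)] into [(1/v) log q_v] of
    [X^* (sA (x) sB)^(-v) X] and [D_alpha(rho || sA (x) id)] into
    [(1/u) log q_u] of [X^* (sA^(-u) (x) id) X], while [H_beta] is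
    [-(1/w) log q_w(rho_B)].  These two operators and
    [X^* (id (x) sB^w) X] (at [z = 0]) are the values at [v], [u], [0] of
    [A_z = X^* (sA^(-z) (x) sB^(-tau z)) X] with [tau] affine, and the chain
    rule is the log-convexity of [z |-> q_z A_z] at these three points.
    No complex interpolation is needed, because one of the points is 0: by
    Hoelder, [q_z A] is the maximum (if [z > 0]) or minimum (if [z < 0], over
    states whose support contains that of [A]) of [tr (A o^z)] over states
    [o]; choose [o] optimal for the negative end point, or for the middle
    point when none is negative.  Then [tr (A_z o^z)] is a sum of exponentials
    in [z] with nonnegative coefficients, so scalar Hoelder applies, and at
    [z = 0] it does not depend on [o].
    The same variational formula compares [tr (rho_B sB^w)] with
    [q_w(rho_B)]; for the upper bounds on the mutual information take [sB]
    proportional to [rho_B^beta]. *)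

(** * Scalar inequalities *)

Section Scalar.
Variable R : realType.
Implicit Types (I J : finType) (p z t : R).

Lemma eq_ler (x y : R) : x = y -> x <= y.
Proof. by move->. Qed.

Lemma powRV (a r : R) : 0 <= a -> (a^-1) `^ r = (a `^ r)^-1.
Proof. by move=> a0; rewrite -powR_inv1 // -powRrM mulN1r powRN. Qed.

(** After division by the right-hand side, each term is bounded by Young's inequality for the
    normalized values [x i / \sum_i x i] and [y i / \sum_i y i]; these bounds add up to
    [(1 - t) + t = 1]. If one of the totals is zero, every term on the left vanishes. *)
Lemma hoelder_sum I (x y : I -> R) t : 0 < t < 1 ->
  (forall i, 0 <= x i) -> (forall i, 0 <= y i) ->
  \sum_i x i `^ (1 - t) * y i `^ t <= (\sum_i x i) `^ (1 - t) * (\sum_i y i) `^ t.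
Proof.
move=> /andP[t0 t1] x0 y0.
have t1' : 0 < 1 - t by rewrite subr_gt0.
have rhs0 : 0 <= (\sum_i x i) `^ (1 - t) * (\sum_i y i) `^ t.
  by rewrite mulr_ge0 ?powR_ge0.
have [X0|X0] := eqVneq (\sum_i x i) 0.
  rewrite big1 // => i _;
  have -> : x i = 0 by apply/eqP; move: X0 => /psumr_eq0P -> //.
  by rewrite powR0 ?mul0r ?gt_eqF.
have [Y0|Y0] := eqVneq (\sum_i y i) 0.
  rewrite big1 // => i _.
  have -> : y i = 0 by apply/eqP; move: Y0 => /psumr_eq0P -> //.
  by rewrite powR0 ?mulr0 ?gt_eqF.
have Xp : 0 < \sum_i x i by rewrite lt0r X0 sumr_ge0.
have Yp : 0 < \sum_i y i by rewrite lt0r Y0 sumr_ge0.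
have Hp : 0 < (\sum_i x i) `^ (1 - t) * (\sum_i y i) `^ t.
  by rewrite mulr_gt0 ?powR_gt0.
rewrite -[leRHS]mul1r -ler_pdivrMr // mulr_suml.
have key i : x i `^ (1 - t) * y i `^ t /
    ((\sum_i x i) `^ (1 - t) * (\sum_i y i) `^ t)
    <= x i / (\sum_i x i) * (1 - t) + y i / (\sum_i y i) * t.
  have -> : x i `^ (1 - t) * y i `^ t /
    ((\sum_i x i) `^ (1 - t) * (\sum_i y i) `^ t) =
    (x i / \sum_i x i) `^ (1 - t) * (y i / \sum_i y i) `^ t.
    rewrite !powRM ?invr_ge0 ?(ltW Xp) ?(ltW Yp) // !powRV ?ltW //.
    by rewrite invfM mulrACA.
  have := @conjugate_powR R ((x i / \sum_i x i) `^ (1 - t))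
     ((y i / \sum_i y i) `^ t) (1 - t)^-1 t^-1.
  rewrite !invrK -!powRrM !mulfV ?gt_eqF // !powRr1; last 2 first.
  - by rewrite divr_ge0 // ltW.
  - by rewrite divr_ge0 // ltW.
  by apply; rewrite ?powR_ge0 ?invr_gt0 // subrK.
apply: (le_trans (ler_sum _ (fun i _ => key i))).
rewrite big_split /= -!mulr_suml !mulfV ?gt_eqF // !mul1r; lra.
Qed.

Lemma hoelder_sum2 I J (x y : I -> J -> R) t : 0 < t < 1 ->
  (forall i j, 0 <= x i j) -> (forall i j, 0 <= y i j) ->
  \sum_i \sum_j x i j `^ (1 - t) * y i j `^ t <=
  (\sum_i \sum_j x i j) `^ (1 - t) * (\sum_i \sum_j y i j) `^ t.
Proof.
move=> ht x0 y0; rewrite !pair_bigA /=.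
exact: (@hoelder_sum _ (fun ij : I * J => x ij.1 ij.2) (fun ij => y ij.1 ij.2)).
Qed.

(** * Variational bounds with doubly stochastic weights *)

Section DoublyStochastic.
Variables (I : finType) (w : I -> I -> R) (o l : I -> R).
Hypothesis w0 : forall k i, 0 <= w k i.
Hypothesis wr : forall k, \sum_i w k i = 1.
Hypothesis wc : forall i, \sum_k w k i = 1.
Hypothesis o0 : forall k, 0 <= o k.
Hypothesis o1 : \sum_k o k = 1.
Hypothesis l0 : forall i, 0 <= l i.

(** Hoelder with exponents [1 - z] and [z]: the column sums of [w] reduce the first total to the
    power sum of [l], and the row sums reduce the second to the total mass 1 of [o]. *)
Lemma variational_sup z : 0 < z < 1 ->
  \sum_k o k `^ z * (\sum_i w k i * l i) <= (\sum_i l i `^ (1 - z)^-1) `^ (1 - z).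
Proof.
move=> /andP[z0 z1]; have z1' : 0 < 1 - z by rewrite subr_gt0.
have := @hoelder_sum2 _ _ (fun k i => w k i * l i `^ (1 - z)^-1)
  (fun k i => w k i * o k) z.
rewrite z0 z1 => /(_ isT).
have -> : \sum_k \sum_i w k i * o k = 1.
  by rewrite -o1; apply: eq_bigr => k _; rewrite -mulr_suml wr mul1r.
rewrite [X in _ -> _ -> _ <= X `^ _ * _]exchange_big /=.
have -> : \sum_i \sum_k w k i * l i `^ (1 - z)^-1 = \sum_i l i `^ (1 - z)^-1.
  by apply: eq_bigr => i _; rewrite -mulr_suml wc mul1r.
rewrite powR1 mulr1 => H; apply: le_trans (H _ _).
- apply: ler_sum => k _; rewrite mulr_sumr; apply: ler_sum => i _.
  rewrite !powRM ?powR_ge0 // -powRrM mulVf ?gt_eqF // powRr1 //.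
  rewrite mulrACA -powRD; last by rewrite subrK oner_eq0.
  by rewrite subrK powRr1 //; apply: eq_ler; ring.
- by move=> k i; rewrite mulr_ge0 ?powR_ge0.
- by move=> k i; rewrite mulr_ge0.
Qed.

(** Ordinary Hoelder read backwards: for [p = 1/(1-z) < 1], factor [l^p] as [(o^z l)^p o^(1-p)],
    where the powers of [o] cancel because [z p + 1 - p = 0]. At [o k = 0] the factorization fails,
    and the support hypothesis makes the terms vanish. *)
Lemma variational_inf z : z < 0 ->
  (forall k, o k = 0 -> \sum_i w k i * l i = 0) ->
  (\sum_i l i `^ (1 - z)^-1) `^ (1 - z) <= \sum_k o k `^ z * (\sum_i w k i * l i).
Proof.
move=> z0 supp; have z1' : 1 < 1 - z by rewrite ltrDl oppr_gt0.
have zp : 0 < 1 - z by rewrite (lt_trans _ z1').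
set p := (1 - z)^-1.
have p0 : 0 < p by rewrite invr_gt0.
have p1 : p < 1 by rewrite invf_lt1.
have B0 : 0 <= \sum_k o k `^ z * (\sum_i w k i * l i).
  by apply: sumr_ge0 => k _; rewrite mulr_ge0 ?powR_ge0 ?sumr_ge0 // => i _; rewrite mulr_ge0.
suff H : \sum_i l i `^ p <= (\sum_k o k `^ z * (\sum_i w k i * l i)) `^ p.
  have {1}-> : \sum_k o k `^ z * (\sum_i w k i * l i) =
      (\sum_k o k `^ z * (\sum_i w k i * l i)) `^ p `^ (1 - z).
    by rewrite -powRrM mulVf ?gt_eqF // powRr1.
  apply: ge0_ler_powR; rewrite ?(ltW zp) ?nnegrE ?powR_ge0 //.
  by rewrite sumr_ge0 // => i _; rewrite powR_ge0.
have := @hoelder_sum2 _ _ (fun k i => w k i * (o k `^ z * l i))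
  (fun k i => w k i * o k) (1 - p).
rewrite subKr.
have -> : \sum_k \sum_i w k i * o k = 1.
  by rewrite -o1; apply: eq_bigr => k _; rewrite -mulr_suml wr mul1r.
have -> : \sum_k \sum_i w k i * (o k `^ z * l i) =
    \sum_k o k `^ z * (\sum_i w k i * l i).
  by apply: eq_bigr => k _; rewrite mulr_sumr; apply: eq_bigr => i _; ring.
rewrite powR1 mulr1 => H; apply: le_trans (H _ _ _).
- have -> : \sum_i l i `^ p = \sum_k \sum_i w k i * l i `^ p.
    by rewrite exchange_big; apply: eq_bigr => i _; rewrite -mulr_suml wc mul1r.
  apply: ler_sum => k _; apply: ler_sum => i _.
  have [ok0|ok0] := eqVneq (o k) 0.
    have /psumr_eq0P : \sum_i w k i * l i = 0 by apply: supp.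
    move=> /(_ (fun i _ => mulr_ge0 (w0 k i) (l0 i)) i isT) /eqP.
    rewrite mulf_eq0 => /orP[] /eqP ->; first by rewrite mul0r mulr_ge0 ?powR_ge0.
    by rewrite powR0 ?gt_eqF // mulr0 mulr_ge0 ?powR_ge0.
  rewrite !powRM ?powR_ge0 ?mulr_ge0 ?powR_ge0 //.
  have -> : w k i `^ p * ((o k `^ z) `^ p * l i `^ p) * (w k i `^ (1 - p) * o k `^ (1 - p))
   = (w k i `^ p * w k i `^ (1 - p)) * (((o k `^ z) `^ p * o k `^ (1 - p)) * l i `^ p) by ring.
  rewrite -powRrM -!powRD ?ok0 ?implybT //; last by rewrite subrKC oner_eq0.
  rewrite subrKC powRr1 //.
  have -> : z * p + (1 - p) = 0.
    by rewrite /p; field; rewrite gt_eqF.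
  by rewrite powRr0 mul1r.
- by rewrite subr_gt0 p1 gtrBl.
- by move=> k i; rewrite !mulr_ge0 ?powR_ge0.
- by move=> k i; rewrite mulr_ge0.
Qed.

End DoublyStochastic.
End Scalar.

(** * Spectral calculus *)

Section Spectral.
Variable R : realType.
Local Notation C := (R[i]).
Local Notation "x %:C" := (real_complex R x) (at level 1, format "x %:C").
Local Notation Re := (@complex.Re R).
Local Notation Im := (@complex.Im R).

Definition sqn (z : C) : R := Re z ^+ 2 + Im z ^+ 2.

Lemma sqn_ge0 z : 0 <= sqn z.
Proof. by rewrite addr_ge0 ?sqr_ge0. Qed.

Lemma sqnE z : z * Num.conj z = (sqn z)%:C.
Proof. by rewrite -normCK -add_Re2_Im2. Qed.

Lemma sqn_eq0 z : sqn z = 0 -> z = 0.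
Proof.
move=> h; have : z * Num.conj z = 0 by rewrite sqnE h.
by move/eqP; rewrite mulf_eq0 conjC_eq0 orbb => /eqP.
Qed.

Lemma sqn0 : sqn 0 = 0.
Proof. by apply: complexI; rewrite -sqnE mul0r. Qed.

Lemma sqn_conj z : sqn (Num.conj z) = sqn z.
Proof. by apply: complexI; rewrite -!sqnE conjCK mulrC. Qed.

Lemma Re_sum I (r : seq I) (P : pred I) (F : I -> C) :
  Re (\sum_(i <- r | P i) F i) = \sum_(i <- r | P i) Re (F i).
Proof. by apply: (big_morph Re) => // -[? ?] [? ?]. Qed.

Definition rdiag n (d : 'I_n -> R) : 'M[C]_n := diag_mx (\row_i (d i)%:C).

Lemma adjmxM m n p (A : 'M[C]_(m, n)) (B : 'M[C]_(n, p)) :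
  adjmx (A *m B) = adjmx B *m adjmx A.
Proof. by rewrite /adjmx trmx_mul map_mxM. Qed.

Lemma adjmxK m n (A : 'M[C]_(m, n)) : adjmx (adjmx A) = A.
Proof. by apply/matrixP => i j; rewrite !mxE conjCK. Qed.

Lemma adjmxE m n (A : 'M[C]_(m, n)) i j : adjmx A i j = Num.conj (A j i).
Proof. by rewrite !mxE. Qed.

Lemma adj_rdiag n (d : 'I_n -> R) : adjmx (rdiag d) = rdiag d.
Proof.
apply/matrixP => i j; rewrite !mxE eq_sym.
case: eqP => [->|_]; last by rewrite !mulr0n rmorph0.
by rewrite !mulr1n; exact: conjc_real.
Qed.

Lemma mul_rdiagl m n (d : 'I_m -> R) (A : 'M[C]_(m, n)) i j :
  (rdiag d *m A) i j = (d i)%:C * A i j.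
Proof. by rewrite mul_diag_mx !mxE. Qed.

Lemma mul_rdiagr m n (d : 'I_n -> R) (A : 'M[C]_(m, n)) i j :
  (A *m rdiag d) i j = A i j * (d j)%:C.
Proof. by rewrite mul_mx_diag !mxE. Qed.

Lemma mul_rdiag n (d e : 'I_n -> R) :
  rdiag d *m rdiag e = rdiag (fun i => d i * e i).
Proof.
apply/matrixP => i j; rewrite mul_rdiagl !mxE.
by case: eqP => [->|_]; rewrite ?mulr1n ?mulr0n ?mulr0 // rmorphM.
Qed.

Lemma eq_rdiag n (d e : 'I_n -> R) : d =1 e -> rdiag d = rdiag e.
Proof. by move=> h; congr diag_mx; apply/rowP => i; rewrite !mxE h. Qed.

Lemma diag_congr m n (X : 'M[C]_(m, n)) d k :
  (X *m rdiag d *m adjmx X) k k = (\sum_i d i * sqn (X k i))%:C.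
Proof.
rewrite mxE rmorph_sum; apply: eq_bigr => i _.
by rewrite mul_rdiagr adjmxE rmorphM /= -sqnE mulrAC mulrC.
Qed.

Lemma mxtrace_rdiag n (d : 'I_n -> R) : \tr (rdiag d) = (\sum_i d i)%:C.
Proof.
by rewrite mxtrace_diag rmorph_sum; apply: eq_bigr => i _; rewrite mxE.
Qed.

Definition isometric n (U : 'M[C]_n) := U *m adjmx U = 1%:M.

Lemma isometricC n (U : 'M[C]_n) : isometric U -> adjmx U *m U = 1%:M.
Proof. exact: mulmx1C. Qed.

Lemma isometric_adj n (U : 'M[C]_n) : isometric U -> isometric (adjmx U).
Proof. by move=> /isometricC h; rewrite /isometric adjmxK. Qed.

Lemma isometric_mul n (U V : 'M[C]_n) :
  isometric U -> isometric V -> isometric (U *m V).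
Proof.
move=> hU hV; rewrite /isometric adjmxM mulmxA -(mulmxA U) hV mulmx1.
exact: hU.
Qed.

Lemma isometric1 n : isometric (1%:M : 'M[C]_n).
Proof.
rewrite /isometric mul1mx /adjmx trmx1.
by apply/matrixP => i j; rewrite !mxE rmorph_nat.
Qed.

Lemma isometric_row n (U : 'M[C]_n) : isometric U ->
  forall k, \sum_i sqn (U k i) = 1.
Proof.
move=> hU k; apply: complexI; have := diag_congr U (fun=> 1) k.
under [in RHS]eq_bigr do rewrite mul1r.
move=> <-; have -> : rdiag (fun=> 1) = 1%:M :> 'M[C]_n.
  by apply/matrixP => i j; rewrite !mxE.
by rewrite mulmx1 hU mxE eqxx.
Qed.

Lemma isometric_col n (U : 'M[C]_n) : isometric U ->
  forall i, \sum_k sqn (U k i) = 1.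
Proof.
move=> /isometric_adj/isometric_row h i; rewrite -(h i).
by apply: eq_bigr => k _; rewrite adjmxE sqn_conj.
Qed.

(** [mpow] uses the one decomposition chosen by [spectralmx]. Admitting any unitary and any order of
    eigenvalues lets tensor products and optimal states keep the decomposition they are built
    from. *)
Record eigdec n (A U : 'M[C]_n) (d : 'I_n -> R) : Prop := EigDec {
  eigdec_iso : isometric U;
  eigdec_ge0 : forall i, 0 <= d i;
  eigdecE : A = adjmx U *m rdiag d *m U }.

Lemma eigdec_diag n (A U : 'M[C]_n) d : eigdec A U d ->
  U *m A *m adjmx U = rdiag d.
Proof.
by case=> hU _ ->; rewrite !mulmxA hU mul1mx -mulmxA hU mulmx1.
Qed.

(** [W = U V^*] intertwines the two diagonal matrices, so [W i j] is nonzero only if [d i = e j];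
    hence it also intertwines their images under [f]. *)
Lemma fun_calculus n (U V : 'M[C]_n) d e (f : R -> R) :
  isometric U -> isometric V ->
  adjmx U *m rdiag d *m U = adjmx V *m rdiag e *m V ->
  adjmx U *m rdiag (f \o d) *m U = adjmx V *m rdiag (f \o e) *m V.
Proof.
move=> hU hV h.
have h1 : rdiag d *m (U *m adjmx V) = (U *m adjmx V) *m rdiag e.
  transitivity (U *m (adjmx U *m rdiag d *m U) *m adjmx V).
    by rewrite !mulmxA hU mul1mx.
  by rewrite h !mulmxA -(mulmxA _ V) hV mulmx1.
have h2 : rdiag (f \o d) *m (U *m adjmx V) = (U *m adjmx V) *m rdiag (f \o e).
  apply/matrixP => i j; move/matrixP: h1 => /(_ i j).
  rewrite !mul_rdiagl !mul_rdiagr mulrC => /eqP.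
  rewrite -subr_eq0 -mulrBr mulf_eq0 => /orP[/eqP ->|].
    by rewrite mul0r mulr0.
  by rewrite subr_eq0 => /eqP/complexI /= ->; rewrite mulrC.
transitivity (adjmx U *m (rdiag (f \o d) *m (U *m adjmx V)) *m V).
  by rewrite !mulmxA -(mulmxA _ (adjmx V)) (isometricC hV) mulmx1.
by rewrite h2 !mulmxA (isometricC hU) mul1mx.
Qed.

Lemma psd_eigdec n (A : 'M[C]_n) : psdmx A ->
  eigdec A (spectralmx A) (fun i => Re (spectral_diag A 0 i)).
Proof.
move=> [Ah Ap].
have Uu := spectral_unitarymx A.
have hU : isometric (spectralmx A) by move/unitarymxP: (Uu).
have An : A \is normalmx.
  apply/normalmxP; change (A *m adjmx A = adjmx A *m A); by rewrite Ah.
move/orthomx_spectralP: An => AE.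
have iE : invmx (spectralmx A) = adjmx (spectralmx A) by rewrite invmx_unitary.
rewrite iE in AE.
(* The eigenvalue is the quadratic form evaluated at the corresponding eigenvector. *)
have s0 i : 0 <= spectral_diag A 0 i.
  have := Ap (col i (adjmx (spectralmx A))).
  have -> : adjmx (col i (adjmx (spectralmx A))) = row i (spectralmx A).
    by apply/matrixP => a b; rewrite !mxE conjCK.
  rewrite -row_mul.
  set X := (X in 0 <= X); suff -> : X = spectral_diag A 0 i by [].
  rewrite /X.
  have -> : (row i (spectralmx A *m A) *m col i (adjmx (spectralmx A))) 0 0 =
     (spectralmx A *m A *m adjmx (spectralmx A)) i i.
    by rewrite !mxE; apply: eq_bigr => j _; rewrite !mxE.
  rewrite {2}AE !mulmxA hU mul1mx -mulmxA hU mulmx1.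
  by rewrite mxE eqxx mulr1n.
have sE i : spectral_diag A 0 i = (Re (spectral_diag A 0 i))%:C.
  by rewrite RRe_real // realE s0.
split; first exact: hU.
- by move=> i; rewrite -ler0c -sE.
- rewrite {1}AE; congr (_ *m diag_mx _ *m _); apply/rowP => i; rewrite !mxE.
  exact: sE.
Qed.

Lemma psd_gram m n (X : 'M[C]_(m, n)) : psdmx (adjmx X *m X).
Proof.
split; first by rewrite /Defs.hermitian adjmxM adjmxK.
move=> v; rewrite !mulmxA -mulmxA -adjmxM mxE.
by apply: sumr_ge0 => i _; rewrite adjmxE mulrC sqnE ler0c sqn_ge0.
Qed.

(** If [U] diagonalizes [sigma] and [Y = U X], this is [X^* f(sigma) X], with [s] the values of [f]
    on the eigenvalues. All interpolated operators take this form with one common [Y]. *)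
Definition gramw m n (Y : 'M[C]_(m, n)) (s : 'I_m -> R) : 'M[C]_n :=
  adjmx Y *m rdiag s *m Y.

Lemma psd_gramw m n (Y : 'M[C]_(m, n)) s : (forall i, 0 <= s i) ->
  psdmx (gramw Y s).
Proof.
move=> s0; have -> : gramw Y s =
    adjmx (rdiag (fun i => Num.sqrt (s i)) *m Y) *m
      (rdiag (fun i => Num.sqrt (s i)) *m Y).
  rewrite adjmxM adj_rdiag mulmxA.
  rewrite -(mulmxA (adjmx Y) (rdiag (fun i => Num.sqrt (s i)))) mul_rdiag.
  by rewrite (@eq_rdiag _ (fun i => _ * _) s) // => i; rewrite -expr2 sqr_sqrtr.
exact: psd_gram.
Qed.

Lemma eigdec_psd n (A U : 'M[C]_n) d : eigdec A U d -> psdmx A.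
Proof. by case=> _ d0 ->; exact: psd_gramw. Qed.

Lemma mpow_eigdec n (A U : 'M[C]_n) d t : eigdec A U d ->
  mpow A t = adjmx U *m rdiag (fun i => d i `^ t) *m U.
Proof.
move=> h; have [hV e0 AE] := psd_eigdec (eigdec_psd h).
case: h => hU d0 AE'.
rewrite /mpow (invmx_unitary (spectral_unitarymx A)).
rewrite -[LHS]/(adjmx (spectralmx A) *m rdiag ((fun x : R => x `^ t) \o
  (fun i => Re (spectral_diag A 0 i))) *m spectralmx A).
by apply: (fun_calculus (fun x : R => x `^ t) hV hU); rewrite -AE.
Qed.

Lemma eigdec_mpow n (A U : 'M[C]_n) d t : eigdec A U d ->
  eigdec (mpow A t) U (fun i => d i `^ t).
Proof.
move=> h; have [hU d0 _] := h.
by split=> //; [move=> i; exact: powR_ge0 | exact: mpow_eigdec].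
Qed.

Lemma retr_eigdec n (A U : 'M[C]_n) d : eigdec A U d -> retr A = \sum_i d i.
Proof.
case=> hU _ ->; rewrite /retr mxtrace_mulC mulmxA hU mul1mx.
by rewrite mxtrace_rdiag.
Qed.

Lemma retr_mpow n (A U : 'M[C]_n) d t : eigdec A U d ->
  retr (mpow A t) = \sum_i d i `^ t.
Proof. by move=> h; rewrite (retr_eigdec (eigdec_mpow t h)). Qed.

(* Both Gram matrices are diagonalized at once by [W = U Y V^*], which
   satisfies [W i j = 0] unless the [i]-th and [j]-th eigenvalues agree. *)
Lemma retr_mpow_gramC n (Y : 'M[C]_n) t : t != 0 ->
  retr (mpow (Y *m adjmx Y) t) = retr (mpow (adjmx Y *m Y) t).
Proof.
move=> t0.
have gramY : psdmx (Y *m adjmx Y).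
  by have := psd_gram (adjmx Y); rewrite adjmxK.
have [U [d hd]] : exists U, exists d, eigdec (Y *m adjmx Y) U d.
  by eexists; eexists; exact: (psd_eigdec gramY).
have [V [e he]] : exists V, exists e, eigdec (adjmx Y *m Y) V e.
  by eexists; eexists; exact: (psd_eigdec (psd_gram Y)).
rewrite (retr_mpow _ hd) (retr_mpow _ he).
have hU := eigdec_iso hd; have hV := eigdec_iso he.
set W := U *m Y *m adjmx V.
have WW : W *m adjmx W = rdiag d.
  rewrite -(eigdec_diag hd) /W !adjmxM adjmxK !mulmxA.
  by rewrite -(mulmxA _ _ V) (isometricC hV) mulmx1.
have WW' : adjmx W *m W = rdiag e.
  rewrite -(eigdec_diag he) /W !adjmxM adjmxK !mulmxA.
  by rewrite -(mulmxA _ _ U) (isometricC hU) mulmx1.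
have dE i : d i = \sum_j sqn (W i j).
  apply: complexI; transitivity ((W *m adjmx W) i i).
    by rewrite WW !mxE eqxx mulr1n.
  by rewrite mxE rmorph_sum; apply: eq_bigr => j _; rewrite adjmxE sqnE.
have eE j : e j = \sum_i sqn (W i j).
  apply: complexI; transitivity ((adjmx W *m W) j j).
    by rewrite WW' !mxE eqxx mulr1n.
  by rewrite mxE rmorph_sum; apply: eq_bigr => i _; rewrite adjmxE mulrC sqnE.
have WE i j : W i j = 0 \/ d i = e j.
  have : rdiag d *m W = W *m rdiag e by rewrite -WW -WW' mulmxA.
  move/matrixP/(_ i j); rewrite mul_rdiagl mul_rdiagr mulrC => /eqP.
  rewrite -subr_eq0 -mulrBr mulf_eq0 => /orP[/eqP|]; first by left.
  by rewrite subr_eq0 => /eqP/complexI; right.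
have powE (x : R) : 0 <= x -> x `^ t = x `^ (t - 1) * x.
  move=> x0; have [->|xn0] := eqVneq x 0; first by rewrite mulr0 powR0.
  by rewrite -{3}(powRr1 x0) -powRD ?xn0 ?implybT // subrK.
transitivity (\sum_i \sum_j d i `^ (t - 1) * sqn (W i j)).
  apply: eq_bigr => i _; rewrite -mulr_sumr -dE powE //; exact: (eigdec_ge0 hd).
rewrite exchange_big /=; apply: eq_bigr => j _.
rewrite [RHS]powE ?(eigdec_ge0 he) // [in X in _ * X]eE mulr_sumr.
apply: eq_bigr => i _.
by case: (WE i j) => [->|->]; rewrite ?sqn0 ?mulr0.
Qed.

End Spectral.

(** * Variational formula and interpolation *)

Section Interpolation.
Variable R : realType.
Local Notation C := (R[i]).
Local Notation "x %:C" := (real_complex R x) (at level 1, format "x %:C").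
Local Notation Re := (@complex.Re R).

(** For positive semidefinite [A] this is the Schatten [p]-norm with [p = 1/(1-z)], which is only a
    quasi-norm when [z < 0]. *)
Definition qn n z (A : 'M[C]_n) : R := retr (mpow A (1 - z)^-1) `^ (1 - z).

Lemma qn_ge0 n z (A : 'M[C]_n) : 0 <= qn z A.
Proof. exact: powR_ge0. Qed.

(** The diagonal of [A] in the orthonormal basis given by [H]. Summed against the numbers [o k]
    raised to the power [z], it gives the trace of [A o^z] for the operator [o] with eigenvalues
    [o k] in that basis. *)
Definition dg n (H A : 'M[C]_n) k : R := Re ((H *m A *m adjmx H) k k).

Lemma dg_gramw m n (H : 'M[C]_n) (Y : 'M[C]_(m, n)) s k :
  dg H (gramw Y s) k = \sum_i sqn ((H *m adjmx Y) k i) * s i.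
Proof.
rewrite /dg /gramw.
have -> : H *m (adjmx Y *m rdiag s *m Y) *m adjmx H =
    (H *m adjmx Y) *m rdiag s *m adjmx (H *m adjmx Y).
  by rewrite adjmxM adjmxK !mulmxA.
by rewrite diag_congr; apply: eq_bigr => i _; rewrite mulrC.
Qed.

Lemma sum_dg n (H A : 'M[C]_n) : isometric H -> \sum_k dg H A k = retr A.
Proof.
move=> hH; rewrite /dg -Re_sum.
rewrite -[X in Re X]/(\tr (H *m A *m adjmx H)).
by rewrite mxtrace_mulC mulmxA (isometricC hH) mul1mx.
Qed.

Lemma psd_retr_gt0P n (A U : 'M[C]_n) d (p : R) : eigdec A U d -> p != 0 ->
  (0 < \sum_i d i `^ p) = (0 < retr A).
Proof.
move=> h p0; rewrite (retr_eigdec h).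
have d0 := eigdec_ge0 h.
rewrite !lt0r !sumr_ge0 ?andbT //; last by move=> i _; exact: powR_ge0.
congr (~~ _); apply/eqP/eqP.
- move=> /psumr_eq0P H; rewrite big1 // => i _.
  by apply: (@powR_eq0_eq0 _ _ p); apply: H => // j _; exact: powR_ge0.
- move=> /psumr_eq0P H; rewrite big1 // => i _.
  by rewrite H // powR0.
Qed.

Lemma qn_gt0 n z (A : 'M[C]_n) : psdmx A -> z < 1 -> 0 < retr A -> 0 < qn z A.
Proof.
move=> /psd_eigdec h z1 A0; apply: powR_gt0.
by rewrite (retr_mpow _ h) (psd_retr_gt0P h) // invr_neq0 // subr_eq0 gt_eqF.
Qed.

Section Variational.
Variables (n : nat) (A H : 'M[C]_n) (o : 'I_n -> R).
Hypothesis psdA : psdmx A.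
Hypothesis hH : isometric H.
Hypothesis o0 : forall k, 0 <= o k.
Hypothesis o1 : \sum_k o k = 1.

(** Each [dg H A k] is an average of the eigenvalues of [A], weighted by the squared moduli of the
    entries of the unitary [H U^*], where [U] diagonalizes [A]. These weights are doubly stochastic,
    so the scalar bound applies. *)
Lemma qn_sup (z : R) : 0 < z < 1 -> \sum_k o k `^ z * dg H A k <= qn z A.
Proof.
move=> hz; have h := psd_eigdec psdA; move: (h) => [hU d0 {1}->].
rewrite /qn (retr_mpow _ h).
under eq_bigr do rewrite -/(gramw _ _) dg_gramw.
apply: (variational_sup (w := fun k i => sqn ((H *m adjmx (spectralmx A)) k i))) => //.
- by move=> k i; exact: sqn_ge0.
- by move=> k; apply: isometric_row; apply: isometric_mul => //; exact: isometric_adj.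
- by move=> i; apply: isometric_col; apply: isometric_mul => //; exact: isometric_adj.
Qed.

Lemma qn_inf (z : R) : z < 0 -> (forall k, o k = 0 -> dg H A k = 0) ->
  qn z A <= \sum_k o k `^ z * dg H A k.
Proof.
move=> hz; have h := psd_eigdec psdA; move: (h) => [hU d0 AE].
rewrite /qn (retr_mpow _ h) => supp.
have dgE k : dg H A k = \sum_i sqn ((H *m adjmx (spectralmx A)) k i) *
    Re (spectral_diag A 0 i).
  by rewrite {1}AE -/(gramw _ _) dg_gramw.
under [leRHS]eq_bigr do rewrite dgE.
apply: (variational_inf (w := fun k i => sqn ((H *m adjmx (spectralmx A)) k i))) => //.
- by move=> k i; exact: sqn_ge0.
- by move=> k; apply: isometric_row; apply: isometric_mul => //; exact: isometric_adj.
- by move=> i; apply: isometric_col; apply: isometric_mul => //; exact: isometric_adj.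
- by move=> k /supp; rewrite dgE.
Qed.

End Variational.

Lemma qn_opt n (A : 'M[C]_n) z : psdmx A -> 0 < retr A -> z < 1 ->
  exists H : 'M[C]_n, exists o : 'I_n -> R,
    [/\ isometric H, forall k, 0 <= o k, \sum_k o k = 1,
        forall k, o k = 0 -> dg H A k = 0 &
        qn z A = \sum_k o k `^ z * dg H A k].
Proof.
move=> /psd_eigdec h A0 z1.
set U := spectralmx A in h; set d := (fun i => _) in h.
have hU := eigdec_iso h; have d0 := eigdec_ge0 h.
have zp : 0 < 1 - z by rewrite subr_gt0.
set p := (1 - z)^-1; have pp : 0 < p by rewrite invr_gt0.
have S0 : 0 < \sum_i d i `^ p by rewrite (psd_retr_gt0P h) ?gt_eqF.
set S := \sum_i d i `^ p in S0.
have dgE k : dg U A k = d k.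
  by rewrite /dg (eigdec_diag h) !mxE eqxx mulr1n.
(* the optimal state is proportional to [A^p] *)
exists U, (fun k => d k `^ p / S); split=> //.
- by move=> k; rewrite divr_ge0 ?powR_ge0 // ltW.
- by rewrite -mulr_suml mulfV ?gt_eqF.
- move=> k /eqP; rewrite dgE mulf_eq0 invr_eq0 (gt_eqF S0) orbF.
  by move/eqP/powR_eq0_eq0.
- rewrite /qn (retr_mpow _ h) -/p -/S.
  (* Since [p z + 1 = p], each summand is again the [p]-th power of an eigenvalue, up to the common
     factor [S^(-z)]. *)
  have -> : \sum_k (d k `^ p / S) `^ z * dg U A k = S * (S `^ z)^-1.
    rewrite /S mulr_suml; apply: eq_bigr => k _; rewrite dgE -/S.
    rewrite powRM ?powR_ge0 ?invr_ge0 ?(ltW S0) // powRV ?(ltW S0) //.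
    rewrite mulrAC; congr (_ * _).
    have [->|dk0] := eqVneq (d k) 0; first by rewrite mulr0 powR0 ?gt_eqF.
    rewrite -powRrM -{2}(powRr1 (d0 k)) -powRD ?dk0 ?implybT //.
    by congr (_ `^ _); rewrite /p; field; rewrite gt_eqF.
  by rewrite -powRN -{2}(powRr1 (ltW S0)) -powRD // gt_eqF ?implybT.
Qed.

(** * Interpolation of weighted Gram matrices *)

Section Interp.
Variables (m n : nat) (Y : 'M[C]_(m, n)).
Variables (s0 s1 sm : 'I_m -> R) (t : R).
Hypothesis s0_ge0 : forall i, 0 <= s0 i.
Hypothesis s1_ge0 : forall i, 0 <= s1 i.
Hypothesis sm_ge0 : forall i, 0 <= sm i.
Hypothesis t01 : 0 < t < 1.
(** Powers of a zero eigenvalue are set to 0, so the geometric-mean bound can fail at such an index;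
    the first alternative covers this by letting the index carry no weight in [Y]. *)
Hypothesis dom : forall i, (forall k, Y i k = 0) \/
  sm i <= s0 i `^ (1 - t) * s1 i `^ t.

(* The support condition is needed only at [z = 0], because [0 `^ 0 = 1]
   whereas [0 `^ z = 0] for every other [z]. *)
Lemma interp_fixed (H : 'M[C]_n) (o : 'I_n -> R) z0 z1 z :
  (forall k, 0 <= o k) -> z = (1 - t) * z0 + t * z1 ->
  (z = 0 -> forall k, o k = 0 -> dg H (gramw Y sm) k = 0) ->
  \sum_k o k `^ z * dg H (gramw Y sm) k <=
  (\sum_k o k `^ z0 * dg H (gramw Y s0) k) `^ (1 - t) *
  (\sum_k o k `^ z1 * dg H (gramw Y s1) k) `^ t.
Proof.
move=> o0 zE supp; set c := fun k i => sqn ((H *m adjmx Y) k i).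
have c0 k i : 0 <= c k i by exact: sqn_ge0.
pose B x s := \sum_k o k `^ x * dg H (gramw Y s) k.
have BE x s : B x s = \sum_k \sum_i o k `^ x * s i * c k i.
  apply: eq_bigr => k _; rewrite dg_gramw mulr_sumr.
  by apply: eq_bigr => i _; rewrite /c; ring.
have suppc : z = 0 -> forall k, o k = 0 -> forall i, c k i * sm i = 0.
  move=> /supp h k /h; rewrite dg_gramw => /psumr_eq0P hh i.
  by apply: hh => // j _; rewrite mulr_ge0 ?sqn_ge0.
have rowc i : (forall k, Y i k = 0) -> forall k, c k i = 0.
  move=> Y0 k; rewrite /c mxE big1 ?sqn0 // => j _.
  by rewrite adjmxE Y0 rmorph0 mulr0.
change (B z sm <= B z0 s0 `^ (1 - t) * B z1 s1 `^ t).
clearbody B; rewrite !BE.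
(* Hoelder over all pairs [(k, i)]: the exponents of [o k] combine to [z], those of the overlap
   [c k i] to 1, and the weights combine to the bound in [dom]. *)
have := @hoelder_sum2 R _ _ (fun k i => o k `^ z0 * s0 i * c k i)
  (fun k i => o k `^ z1 * s1 i * c k i) t t01.
move=> hoel; apply: le_trans (hoel _ _); last 2 first.
- by move=> k i; rewrite !mulr_ge0 ?powR_ge0.
- by move=> k i; rewrite !mulr_ge0 ?powR_ge0.
apply: ler_sum => k _; apply: ler_sum => i _.
have rhs0 : 0 <= (o k `^ z0 * s0 i * c k i) `^ (1 - t) *
    (o k `^ z1 * s1 i * c k i) `^ t by rewrite mulr_ge0 ?powR_ge0.
have [ck0|ck0] := eqVneq (c k i) 0; first by rewrite {1}ck0 mulr0.
have [ok0|ok0] := eqVneq (o k) 0.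
  have [/suppc/(_ k ok0 i)|zn0] := eqVneq z 0; last by rewrite {1}ok0 powR0 ?mul0r.
  by move=> h; rewrite -mulrA (mulrC (sm i)) h mulr0.
rewrite !powRM ?mulr_ge0 ?powR_ge0 // -!powRrM.
have -> : o k `^ (z0 * (1 - t)) * s0 i `^ (1 - t) * c k i `^ (1 - t) *
  (o k `^ (z1 * t) * s1 i `^ t * c k i `^ t) =
  (o k `^ (z0 * (1 - t)) * o k `^ (z1 * t)) * (s0 i `^ (1 - t) * s1 i `^ t)
   * (c k i `^ (1 - t) * c k i `^ t) by ring.
rewrite -!powRD ?ck0 ?ok0 ?implybT // subrK powRr1 //.
have -> : z0 * (1 - t) + z1 * t = z by rewrite zE; ring.
apply: ler_wpM2r => //; apply: ler_wpM2l; first exact: powR_ge0.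
case: (dom i) => // /rowc/(_ k) h; by rewrite h eqxx in ck0.
Qed.

Lemma retr_gramw s : retr (gramw Y s) = \sum_i s i * \sum_k sqn (Y i k).
Proof.
rewrite -(sum_dg _ (isometric1 R n)).
under eq_bigr do rewrite dg_gramw mul1mx.
rewrite exchange_big; apply: eq_bigr => i _; rewrite mulr_sumr.
by apply: eq_bigr => k _; rewrite adjmxE sqn_conj mulrC.
Qed.

Hypothesis sm_gt0 : 0 < retr (gramw Y sm).

(** A positive middle trace yields an index with [sm i > 0] and a nonzero row of [Y]; there [dom]
    forces both end weights to be positive. *)
Lemma interp_ends_gt0 : 0 < retr (gramw Y s0) /\ 0 < retr (gramw Y s1).
Proof.
have [i hi] : exists i, 0 < sm i * \sum_k sqn (Y i k).
  apply/existsP; rewrite -[X in is_true X]negbK negb_exists.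
  apply/negP => /forallP h; move: sm_gt0; rewrite retr_gramw ltNge => /negP; apply.
  by apply: sumr_le0 => i _; rewrite leNgt.
have r0 j : 0 <= \sum_k sqn (Y j k) by apply: sumr_ge0 => k _; exact: sqn_ge0.
have ri : 0 < \sum_k sqn (Y i k).
  by rewrite lt0r r0 andbT; apply/eqP => h; rewrite h mulr0 ltxx in hi.
have si : 0 < sm i by rewrite -(pmulr_lgt0 _ ri).
have /andP[tp t1] := t01.
have hs : sm i <= s0 i `^ (1 - t) * s1 i `^ t.
  case: (dom i) => // h; move: ri; rewrite big1 ?ltxx // => k _.
  by rewrite h sqn0.
have pos s : (forall j, 0 <= s j) -> s i != 0 -> 0 < retr (gramw Y s).
  move=> sp si0; rewrite retr_gramw (bigD1 i) //=.
  apply: ltr_wpDr; first by apply: sumr_ge0 => j _; rewrite mulr_ge0.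
  by rewrite mulr_gt0 // lt0r si0 sp.
split; apply: pos => //; apply/eqP => h; move: (lt_le_trans si hs);
  rewrite h powR0 ?mul0r ?mulr0 ?ltxx //.
  by rewrite subr_eq0 gt_eqF.
by rewrite gt_eqF.
Qed.

(** At the end point 0 the trace does not see [o]. If [z < 0], take [o] optimal for the end [z] and
    bound the middle by [qn_inf]; if [z > 0], take [o] optimal for the middle and bound the end by
    [qn_sup]. *)
Lemma interp_zero_end (z : R) : z < 1 -> z != 0 ->
  qn (t * z) (gramw Y sm) <=
  retr (gramw Y s0) `^ (1 - t) * qn z (gramw Y s1) `^ t.
Proof.
move=> z1 z0; have /andP[tp t1] := t01.
have [p0 p1] := interp_ends_gt0.
have B0 (H : 'M[C]_n) (o : 'I_n -> R) s : isometric H ->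
    \sum_k o k `^ 0 * dg H (gramw Y s) k = retr (gramw Y s).
  by move=> hH; rewrite -(sum_dg _ hH); apply: eq_bigr => k _; rewrite powRr0 mul1r.
have tz1 : t * z < 1.
  have [zn|zp] := leP z 0.
    by apply: le_lt_trans ltr01; rewrite mulr_ge0_le0 // ltW.
  by apply: lt_trans z1; rewrite gtr_pMl.
move: z0; rewrite neq_lt => /orP[zn|zp].
- have tzn : t * z < 0 by rewrite pmulr_rlt0.
  have [H [o [hH o0 o1 supp ->]]] := qn_opt (psd_gramw Y s1_ge0) p1 z1.
  rewrite -(B0 H o _ hH).
  apply: le_trans (interp_fixed (H := H) (z0 := 0) (z1 := z) (z := t * z) o0 _ _); last 2 first.
  + by rewrite mulr0 add0r.
  + by move=> h; exfalso; move: tzn; rewrite h ltxx.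
  apply: (qn_inf (psd_gramw Y sm_ge0) hH o0 o1 tzn).
  (* By [dom], the middle operator has no weight where the end operator has none, so the optimal [o]
     is admissible for it. *)
  move=> k /supp; rewrite !dg_gramw => /psumr_eq0P hh; apply: big1 => i _.
  have /eqP := hh (fun j _ => mulr_ge0 (sqn_ge0 _) (s1_ge0 j)) i isT.
  rewrite mulf_eq0 => /orP[/eqP ->|/eqP si]; first by rewrite mul0r.
  case: (dom i) => [Y0|].
    rewrite [X in sqn X]mxE big1 ?sqn0 ?mul0r // => j _.
    by rewrite adjmxE Y0 rmorph0 mulr0.
  rewrite si powR0 ?gt_eqF // mulr0 => h.
  have /eqP -> : sm i == 0 by rewrite eq_le h sm_ge0.
  by rewrite mulr0.
- have tzp : 0 < t * z by rewrite mulr_gt0.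
  have [H [o [hH o0 o1 supp ->]]] := qn_opt (psd_gramw Y sm_ge0) sm_gt0 tz1.
  rewrite -(B0 H o _ hH); apply: (le_trans (interp_fixed (H := H) (z := t * z) (z0 := 0) (z1 := z) o0 _ _)).
  + by rewrite mulr0 add0r.
  + by move=> h; exfalso; move: tzp; rewrite h ltxx.
  apply: ler_wpM2l; first exact: powR_ge0.
  apply: ge0_ler_powR; rewrite ?(ltW tp) ?nnegrE ?qn_ge0 //.
    by apply: sumr_ge0 => k _; rewrite dg_gramw mulr_ge0 ?powR_ge0 // sumr_ge0 // => i _; rewrite mulr_ge0 ?sqn_ge0.
  by apply: (qn_sup (psd_gramw Y s1_ge0) hH o0 o1); rewrite zp z1.
Qed.

(** Now the middle trace does not see [o], which is chosen optimal for the negative end; [qn_sup]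
    then bounds the positive end. *)
Lemma interp_zero_mid (z0 z1 : R) : z0 < 0 -> 0 < z1 -> z1 < 1 ->
  (1 - t) * z0 + t * z1 = 0 ->
  retr (gramw Y sm) <= qn z0 (gramw Y s0) `^ (1 - t) * qn z1 (gramw Y s1) `^ t.
Proof.
move=> z0n z1p z11 zE; have /andP[tp t1] := t01.
have [p0 p1] := interp_ends_gt0.
have z01 : z0 < 1 by apply: lt_trans z0n ltr01.
have [H [o [hH o0 o1 supp ->]]] := qn_opt (psd_gramw Y s0_ge0) p0 z01.
have -> : retr (gramw Y sm) = \sum_k o k `^ 0 * dg H (gramw Y sm) k.
  by rewrite -(sum_dg _ hH); apply: eq_bigr => k _; rewrite powRr0 mul1r.
apply: (le_trans (interp_fixed (H := H) (z := 0) (z0 := z0) (z1 := z1) o0 _ _)).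
- by rewrite zE.
- move=> _ k /supp; rewrite !dg_gramw => /psumr_eq0P hh; apply: big1 => i _.
  have /eqP := hh (fun j _ => mulr_ge0 (sqn_ge0 _) (s0_ge0 j)) i isT.
  rewrite mulf_eq0 => /orP[/eqP ->|/eqP si]; first by rewrite mul0r.
  case: (dom i) => [Y0|].
    rewrite [X in sqn X]mxE big1 ?sqn0 ?mul0r // => j _.
    by rewrite adjmxE Y0 rmorph0 mulr0.
  rewrite si powR0 ?subr_eq0 ?gt_eqF // mul0r => h.
  have /eqP -> : sm i == 0 by rewrite eq_le h sm_ge0.
  by rewrite mulr0.
apply: ler_wpM2l; first exact: powR_ge0.
apply: ge0_ler_powR; rewrite ?(ltW tp) ?nnegrE ?qn_ge0 //.
  by apply: sumr_ge0 => k _; rewrite dg_gramw mulr_ge0 ?powR_ge0 // sumr_ge0 // => i _; rewrite mulr_ge0 ?sqn_ge0.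
by apply: (qn_sup (psd_gramw Y s1_ge0) hH o0 o1); rewrite z1p z11.
Qed.

End Interp.
End Interpolation.

(** * Tensor products, partial traces and supports *)

Section Bipartite.
Variable R : realType.
Local Notation C := (R[i]).
Local Notation "x %:C" := (real_complex R x) (at level 1, format "x %:C").
Local Notation Re := (@complex.Re R).

Lemma sum_mxtens (V : nmodType) m n (F : 'I_(m * n) -> V) :
  \sum_k F k = \sum_i \sum_j F (mxtens_index (i, j)).
Proof.
rewrite pair_bigA /=.
rewrite (reindex (fun p : 'I_m * 'I_n => mxtens_index p)) /=.
  by apply: eq_bigr => -[i j].
exists (@mxtens_unindex m n) => k _; [exact: mxtens_indexK|exact: mxtens_unindexK].
Qed.

Lemma tens_rdiag m n (a : 'I_m -> R) (b : 'I_n -> R) :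
  rdiag a *t rdiag b =
  rdiag (fun k => a (mxtens_unindex k).1 * b (mxtens_unindex k).2).
Proof.
apply/matrixP => k l.
case: (mxtens_indexP k) => i j; case: (mxtens_indexP l) => i' j'.
rewrite tensmxE !mxE mxtens_indexK /=.
rewrite (can_eq (@mxtens_indexK m n)) xpair_eqE.
by case: (i == i'); case: (j == j'); rewrite ?mulr1n ?mulr0n ?mul0r ?mulr0 // rmorphM.
Qed.

Lemma adj_tens m n p q (A : 'M[C]_(m, n)) (B : 'M[C]_(p, q)) :
  adjmx (A *t B) = adjmx A *t adjmx B.
Proof. by apply/matrixP => i j; rewrite !mxE rmorphM. Qed.

Lemma rdiag1 n : rdiag (fun=> 1) = 1%:M :> 'M[C]_n.
Proof. by apply/matrixP => i j; rewrite !mxE. Qed.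

Lemma isometric_tens m n (U : 'M[C]_m) (V : 'M[C]_n) :
  isometric U -> isometric V -> isometric (U *t V).
Proof.
rewrite /isometric => hU hV; rewrite adj_tens tensmx_mul hU hV -!rdiag1 tens_rdiag.
by apply: eq_rdiag => k; rewrite mulr1.
Qed.

Lemma eigdec_tens m n (A U : 'M[C]_m) (B V : 'M[C]_n) a b :
  eigdec A U a -> eigdec B V b ->
  eigdec (A *t B) (U *t V)
    (fun k => a (mxtens_unindex k).1 * b (mxtens_unindex k).2).
Proof.
move=> [hU a0 ->] [hV b0 ->]; split.
- exact: isometric_tens.
- by move=> k; rewrite mulr_ge0.
- by rewrite adj_tens -tens_rdiag !tensmx_mul.
Qed.

(** The identity is diagonal in every orthonormal basis; this lets [sA *t 1%:M] and [sA *t sB] share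
    the same product eigenbasis. *)
Lemma eigdec1 n (V : 'M[C]_n) : isometric V -> eigdec 1%:M V (fun=> 1).
Proof.
move=> hV; split; [exact: hV | by [] |].
by rewrite rdiag1 mulmx1 (isometricC hV).
Qed.

Lemma psd_retr_ge0 n (A : 'M[C]_n) : psdmx A -> 0 <= retr A.
Proof.
move=> /psd_eigdec h; rewrite (retr_eigdec h).
by apply: sumr_ge0 => i _; exact: (eigdec_ge0 h).
Qed.

Lemma psd_factor n (A : 'M[C]_n) : psdmx A -> exists X : 'M[C]_n, A = X *m adjmx X.
Proof.
move=> /psd_eigdec [hU d0 AE]; set d := (fun i => _) in d0 AE.
exists (adjmx (spectralmx A) *m rdiag (fun i => Num.sqrt (d i))).
rewrite adjmxM adjmxK adj_rdiag mulmxA.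
rewrite -(mulmxA (adjmx (spectralmx A)) (rdiag (fun i => Num.sqrt (d i)))) mul_rdiag.
rewrite {1}AE; congr (_ *m _ *m _); apply: eq_rdiag => i.
by rewrite -expr2 sqr_sqrtr //; exact: d0.
Qed.

(** With [A = X X^*], cyclicity turns this into the trace of the Gram matrix of [X^* Z]. *)
Lemma mxtrace_psd_ge0 m n (A : 'M[C]_m) (Z : 'M[C]_(m, n)) : psdmx A ->
  0 <= \tr (A *m (Z *m adjmx Z)).
Proof.
move=> /psd_factor[X ->].
have -> : \tr (X *m adjmx X *m (Z *m adjmx Z)) =
    \tr (adjmx (adjmx X *m Z) *m (adjmx X *m Z)).
  by rewrite adjmxM adjmxK mulmxA mxtrace_mulC !mulmxA.
apply: sumr_ge0 => i _; rewrite mxE; apply: sumr_ge0 => j _.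
by rewrite adjmxE mulrC sqnE ler0c sqn_ge0.
Qed.

(** * Partial traces and their diagonal entries *)

Section PartialTrace.
Variables (dA dB : nat).
Implicit Types (rho X : 'M[C]_(dA * dB)).

Lemma mxtrace_ptrB rho (M : 'M[C]_dA) : \tr (ptrB rho *m M) = \tr (rho *m (M *t 1%:M)).
Proof.
rewrite /mxtrace sum_mxtens; apply: eq_bigr => i _.
rewrite mxE; under [RHS]eq_bigr do rewrite mxE sum_mxtens.
rewrite exchange_big /=; apply: eq_bigr => k _.
rewrite mxE mulr_suml; apply: eq_bigr => j _.
rewrite (bigD1 j) //= big1 ?addr0 => [|l lj].
  by rewrite tensmxE mxE eqxx mulr1.
by rewrite tensmxE [1%:M _ _]mxE (negbTE lj) !mulr0.
Qed.

Lemma mxtrace_ptrA rho (M : 'M[C]_dB) : \tr (ptrA rho *m M) = \tr (rho *m (1%:M *t M)).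
Proof.
rewrite /mxtrace sum_mxtens exchange_big; apply: eq_bigr => j _.
rewrite mxE; under [RHS]eq_bigr do rewrite mxE sum_mxtens.
under [RHS]eq_bigr do rewrite exchange_big /=.
rewrite exchange_big /=; apply: eq_bigr => k _.
rewrite mxE mulr_suml; apply: eq_bigr => i _.
rewrite (bigD1 i) //= big1 ?addr0 => [|l li].
  by rewrite tensmxE [1%:M _ _]mxE eqxx mul1r.
by rewrite tensmxE [1%:M _ _]mxE (negbTE li) mul0r mulr0.
Qed.

Lemma psd_ptrB rho : psdmx rho -> psdmx (ptrB rho).
Proof.
move=> hr; split.
  apply/matrixP => i k; rewrite !mxE rmorph_sum; apply: eq_bigr => j _.
  have [/matrixP/(_ (mxtens_index (i, j)) (mxtens_index (k, j))) <- _] := hr.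
  by rewrite !mxE.
move=> v.
have -> : (adjmx v *m ptrB rho *m v) 0 0 = \tr (ptrB rho *m (v *m adjmx v)).
  by rewrite mulmxA mxtrace_mulC mulmxA /mxtrace big_ord1.
rewrite mxtrace_ptrB.
have -> : (v *m adjmx v) *t 1%:M =
    (v *t 1%:M) *m adjmx (v *t 1%:M) :> 'M[C]_(dA * dB).
  rewrite adj_tens tensmx_mul; congr (_ *t _).
  by have := isometric1 R dB; rewrite /isometric => ->.
exact: mxtrace_psd_ge0.
Qed.

Lemma psd_ptrA rho : psdmx rho -> psdmx (ptrA rho).
Proof.
move=> hr; split.
  apply/matrixP => j l; rewrite !mxE rmorph_sum; apply: eq_bigr => i _.
  have [/matrixP/(_ (mxtens_index (i, j)) (mxtens_index (i, l))) <- _] := hr.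
  by rewrite !mxE.
move=> v.
have -> : (adjmx v *m ptrA rho *m v) 0 0 = \tr (ptrA rho *m (v *m adjmx v)).
  by rewrite mulmxA mxtrace_mulC mulmxA /mxtrace big_ord1.
rewrite mxtrace_ptrA.
have -> : 1%:M *t (v *m adjmx v) =
    (1%:M *t v) *m adjmx (1%:M *t v) :> 'M[C]_(dA * dB).
  rewrite adj_tens tensmx_mul; congr (_ *t _).
  by have := isometric1 R dA; rewrite /isometric => ->.
exact: mxtrace_psd_ge0.
Qed.

Lemma retr_ptrA rho : retr (ptrA rho) = retr rho.
Proof.
rewrite /retr; congr Re.
have := mxtrace_ptrA rho 1%:M; rewrite mulmx1 => ->.
by rewrite -!rdiag1 tens_rdiag (@eq_rdiag _ _ _ (fun=> 1)) ?rdiag1 ?mulmx1 // => k; rewrite mulr1.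
Qed.

Section Marginal.
Variables (X : 'M[C]_(dA * dB)) (U : 'M[C]_dA) (V : 'M[C]_dB).
Hypothesis hU : isometric U.
Let rho := X *m adjmx X.
Let Y := (U *t V) *m X.

(** The left side is the trace of [rho] against the identity on the first factor tensored with the
    [j]-th eigenprojection. The basis [U] of the first factor is arbitrary, since the identity does
    not depend on it. *)
Lemma dg_ptrA j : dg V (ptrA rho) j =
  \sum_i \sum_k sqn (Y (mxtens_index (i, j)) k).
Proof.
pose e l : R := (l == j)%:R.
have -> : dg V (ptrA rho) j = Re (\tr (ptrA rho *m gramw V e)).
  rewrite /gramw !mulmxA mxtrace_mulC !mulmxA /mxtrace Re_sum.
  rewrite (bigD1 j) //= big1 ?addr0 => [|l lj].
    by rewrite mul_rdiagr /e eqxx rmorph1 mulr1.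
  by rewrite mul_rdiagr /e (negbTE lj) rmorph0 mulr0.
rewrite mxtrace_ptrA.
have -> : 1%:M *t gramw V e = gramw (U *t V) (fun k => e (mxtens_unindex k).2).
  rewrite /gramw -{1}(isometricC hU) -[X in adjmx U *m X]mul1mx -{1}(rdiag1 dA) mulmxA.
  rewrite -!tensmx_mul -adj_tens tens_rdiag.
  by congr (_ *m _ *m _); apply: eq_rdiag => k; rewrite mul1r.
have -> : \tr (rho *m gramw (U *t V) (fun k => e (mxtens_unindex k).2)) =
    \tr (gramw Y (fun k => e (mxtens_unindex k).2)).
  rewrite /rho /gramw /Y -mulmxA mxtrace_mulC; congr (\tr _).
  by rewrite adjmxM !mulmxA.
rewrite -[Re _]/(retr _) retr_gramw sum_mxtens.
under eq_bigr do under eq_bigr do rewrite mxtens_indexK.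
rewrite exchange_big (bigD1 j) //=.
rewrite [X in _ + X]big1 ?addr0 => [|l lj].
  by apply: eq_bigr => i _; rewrite /e eqxx mul1r.
by apply: big1 => i _; rewrite /e (negbTE lj) mul0r.
Qed.

(** The operator at the point [z = 0] of the interpolation acts on the second factor only, so its
    trace is a function of the marginal alone. *)
Lemma retr_gramw_snd g :
  retr (gramw Y (fun k => g (mxtens_unindex k).2)) =
  \sum_j g j * dg V (ptrA rho) j.
Proof.
rewrite retr_gramw sum_mxtens exchange_big; apply: eq_bigr => j _.
rewrite dg_ptrA mulr_sumr; apply: eq_bigr => i _.
by rewrite mxtens_indexK.
Qed.

Lemma dg_ptrA_eq0 j : dg V (ptrA rho) j = 0 ->
  forall i k, Y (mxtens_index (i, j)) k = 0.
Proof.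
rewrite dg_ptrA => /psumr_eq0P h i k; apply: sqn_eq0.
have /psumr_eq0P h' : \sum_k sqn (Y (mxtens_index (i, j)) k) = 0.
  by apply: h => // l _; apply: sumr_ge0 => m _; exact: sqn_ge0.
by apply: h' => // l _; exact: sqn_ge0.
Qed.

End Marginal.
End PartialTrace.

Lemma mulmx_col m n p (A : 'M[C]_(m, n)) (B : 'M[C]_(n, p)) j :
  A *m col j B = col j (A *m B).
Proof. by rewrite !colE mulmxA. Qed.

(** * Image and kernel conditions in the eigenbasis *)

Section Support.
Variables (n : nat) (X sigma U : 'M[C]_n) (d : 'I_n -> R).
Hypothesis hs : eigdec sigma U d.
Let rho := X *m adjmx X.
Let Y := U *m X.

(** In its eigenbasis, the image of [sigma] consists of the vectors whose coordinates vanish at zero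
    eigenvalues. A common nonzero vector is then some [rho *m x] with this property. *)
Lemma image_capP :
  reflect (exists x : 'cV[C]_n, rho *m x != 0 /\
             forall i, d i = 0 -> (U *m (rho *m x)) i 0 = 0)
    ((rho^T :&: sigma^T)%MS != 0).
Proof.
have hU := eigdec_iso hs.
apply: (iffP rowV0Pn) => [[v]|[x [x0 hx]]].
  rewrite sub_capmx => /andP[/submxP[x vx] /submxP[y vy]] v0.
  have vE : rho *m x^T = v^T by rewrite vx trmx_mul trmxK.
  exists x^T; rewrite vE trmx_eq0; split=> // i di.
  have -> : v^T = adjmx U *m (rdiag d *m (U *m y^T)).
    by rewrite vy trmx_mul trmxK (eigdecE hs) !mulmxA.
  by rewrite !mulmxA hU mul1mx -mulmxA mul_rdiagl di rmorph0 mul0r.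
exists (rho *m x)^T; last by rewrite trmx_eq0.
rewrite sub_capmx trmx_mul submxMl -trmx_mul /=.
(* A preimage under [sigma] is obtained by dividing the coordinates by the eigenvalues; where these
   are zero, the coordinate is zero as well. *)
have -> : rho *m x = sigma *m (adjmx U *m (rdiag (fun i => (d i)^-1) *m (U *m (rho *m x)))).
  move: hx; generalize (rho *m x) => y hx.
  rewrite (eigdecE hs) -!mulmxA (mulmxA U (adjmx U)) hU mul1mx.
  rewrite (mulmxA (rdiag d)) mul_rdiag -[LHS]mul1mx -(isometricC hU) -mulmxA.
  congr (_ *m _); apply/matrixP => i j; rewrite ord1 mul_rdiagl.
  have [di|di] := eqVneq (d i) 0; first by rewrite hx // mulr0.
  by rewrite mulfV // rmorph1 mul1r.
by rewrite trmx_mul submxMl.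
Qed.

(** The kernel of [sigma] is spanned by the eigenvectors with [d i = 0], and [X X^*] kills such a
    vector exactly when [X^*] does, which means that row [i] of [Y] is zero. *)
Lemma ker_subP :
  reflect (forall i, d i = 0 -> forall k, Y i k = 0)
    (kermx sigma^T <= kermx rho^T)%MS.
Proof.
have hU := eigdec_iso hs; have sE := eigdecE hs.
apply: (iffP idP) => [h i di|h].
  pose v := (col i (adjmx U))^T.
  have vs : (v <= kermx sigma^T)%MS.
    apply/sub_kermxP; rewrite /v -trmx_mul mulmx_col sE -mulmxA hU mulmx1.
    by apply/matrixP => a b; rewrite mxE mxE mul_rdiagr di rmorph0 mulr0 mxE.
  have /sub_kermxP := submx_trans vs h.
  rewrite /v -trmx_mul mulmx_col => /matrixP vr.
  have YY : (Y *m adjmx Y) i i = 0.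
    rewrite /Y adjmxM !mulmxA -(mulmxA U) -/rho -mulmxA mxE big1 // => k _.
    by have := vr 0 k; rewrite !mxE => ->; rewrite mulr0.
  have Y0 : \sum_k sqn (Y i k) = 0.
    apply: complexI; rewrite rmorph0 -YY mxE rmorph_sum; apply: eq_bigr => k _.
    by rewrite adjmxE sqnE.
  move=> k; apply: sqn_eq0; move/psumr_eq0P: Y0; apply=> // l _.
  exact: sqn_ge0.
apply/sub_kermxP; set K := kermx _.
have Ks : sigma *m K^T = 0.
  by have /sub_kermxP := submx_refl K => /(congr1 trmx); rewrite trmx_mul trmxK trmx0.
apply: trmx_inj; rewrite trmx_mul trmxK trmx0.
have dK : rdiag d *m (U *m K^T) = 0.
  have := congr1 (mulmx U) Ks; rewrite mulmx0 sE !mulmxA hU mul1mx.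
  by rewrite -mulmxA.
have -> : rho *m K^T = X *m (adjmx Y *m (U *m K^T)).
  by rewrite /rho /Y adjmxM !mulmxA -(mulmxA _ _ U) (isometricC hU) mulmx1.
have -> : adjmx Y *m (U *m K^T) = 0; last by rewrite mulmx0.
apply/matrixP => a b; rewrite mxE [RHS]mxE big1 // => i _.
have [di|di] := eqVneq (d i) 0.
  by rewrite adjmxE h // rmorph0 mul0r.
move/matrixP: dK => /(_ i b); rewrite mul_rdiagl [RHS]mxE => /eqP.
rewrite mulf_eq0 => /orP[/eqP/(@complexI R)|/eqP ->]; last by rewrite mulr0.
by move=> h0; rewrite h0 eqxx in di.
Qed.

(** This makes the argument of the logarithm positive. If the trace were zero, [Y] would vanish on
    the support of [sigma]; the common vector [rho *m x] would then have no coordinates there, and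
    it has none elsewhere. *)
Lemma image_cap_gramw_gt0 (s : 'I_n -> R) : (forall i, 0 <= s i) ->
  (forall i, d i != 0 -> 0 < s i) ->
  (rho^T :&: sigma^T)%MS != 0 -> 0 < retr (gramw Y s).
Proof.
move=> s0 sp /image_capP[x [x0 hx]].
rewrite lt0r psd_retr_ge0 ?andbT; last exact: psd_gramw.
apply/eqP; rewrite retr_gramw => /psumr_eq0P h.
have r0 i : 0 <= \sum_k sqn (Y i k) by apply: sumr_ge0 => k _; exact: sqn_ge0.
have Y0 i : d i != 0 -> forall k, Y i k = 0.
  move=> di k; apply: sqn_eq0.
  have /eqP := h (fun j _ => mulr_ge0 (s0 j) (r0 j)) i isT.
  rewrite mulf_eq0 (gt_eqF (sp i di)) /= => /eqP/psumr_eq0P; apply=> // l _.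
  exact: sqn_ge0.
case/eqP: x0; rewrite -[LHS]mul1mx -(isometricC (eigdec_iso hs)) -mulmxA.
have -> : U *m (rho *m x) = 0; last by rewrite mulmx0.
apply/matrixP => i j; rewrite ord1 [RHS]mxE.
have [di|di] := eqVneq (d i) 0; first exact: hx.
rewrite /rho !mulmxA -/Y -mulmxA mxE big1 // => k _.
by rewrite Y0 // mul0r.
Qed.

End Support.
End Bipartite.

(** * The chain rules *)

Section ChainReal.
Variable R : realType.
Local Notation C := (R[i]).
Variables (m n : nat) (Y : 'M[C]_(m, n)) (a b : 'I_m -> R) (u v w : R).
Hypothesis a0 : forall k, 0 <= a k.
Hypothesis b0 : forall k, 0 <= b k.
Hypothesis un0 : u != 0.
Hypothesis vn0 : v != 0.
Hypothesis wn0 : w != 0.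
Hypothesis uvw : u^-1 = v^-1 + w^-1.
Hypothesis u1 : u < 1.
Hypothesis v1 : v < 1.
Hypothesis nz : exists k l, [/\ a k != 0, b k != 0 & Y k l != 0].

Let sA k := a k `^ (- u).
Let sAB k := (a k * b k) `^ (- v).
Let sB k := b k `^ w.

Let sA0 k : 0 <= sA k. Proof. exact: powR_ge0. Qed.
Let sAB0 k : 0 <= sAB k. Proof. exact: powR_ge0. Qed.
Let sB0 k : 0 <= sB k. Proof. exact: powR_ge0. Qed.

Let w_vu : w * (v - u) = u * v.
Proof.
have -> : v - u = u * v * (u^-1 - v^-1) by field; rewrite un0 vn0.
by rewrite uvw; field; rewrite vn0 wn0.
Qed.

Let vu0 : v - u != 0.
Proof.
by apply/eqP => h; move: w_vu; rewrite h mulr0 => /esym/eqP; rewrite mulf_eq0 (negbTE un0) (negbTE vn0).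
Qed.

Let wE : w = u * v / (v - u).
Proof. by rewrite -w_vu mulfK. Qed.

Lemma gramw_gt0 (s : 'I_m -> R) : (forall k, 0 <= s k) ->
  (forall k, a k != 0 -> b k != 0 -> s k != 0) -> 0 < retr (gramw Y s).
Proof.
move=> s0 sn; have [k [l [ak bk ykl]]] := nz.
have r0 i : 0 <= \sum_j sqn (Y i j) by apply: sumr_ge0 => j _; exact: sqn_ge0.
rewrite retr_gramw (bigD1 k) //=; apply: ltr_wpDr.
  by apply: sumr_ge0 => i _; rewrite mulr_ge0.
apply: mulr_gt0; first by rewrite lt0r sn //= s0.
rewrite lt0r r0 andbT; apply/eqP => /psumr_eq0P h; case/eqP: ykl.
by apply: sqn_eq0; apply: h => // j _; exact: sqn_ge0.
Qed.

Let powRE (x y : R) : 0 < x -> x `^ y = expR (y * ln x).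
Proof. by move=> x0; rewrite /powR gt_eqF. Qed.

Let sA_gt0 : 0 < retr (gramw Y sA).
Proof. by apply: gramw_gt0 => // k ak _; rewrite /sA powR_eq0 negb_and ak. Qed.

Let sAB_gt0 : 0 < retr (gramw Y sAB).
Proof.
by apply: gramw_gt0 => // k ak bk; rewrite /sAB powR_eq0 mulf_eq0 !negb_and negb_or ak bk.
Qed.

Let sB_gt0 : 0 < retr (gramw Y sB).
Proof. by apply: gramw_gt0 => // k _ bk; rewrite /sB powR_eq0 negb_and bk. Qed.

Let qA_gt0 : 0 < qn u (gramw Y sA).
Proof. exact: (qn_gt0 (psd_gramw Y sA0) u1 sA_gt0). Qed.

Let qAB_gt0 : 0 < qn v (gramw Y sAB).
Proof. exact: (qn_gt0 (psd_gramw Y sAB0) v1 sAB_gt0). Qed.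

Let ln_le (x p q t : R) : 0 < x -> 0 < p -> 0 < q -> x <= p `^ (1 - t) * q `^ t ->
  ln x <= (1 - t) * ln p + t * ln q.
Proof.
move=> x0 p0 q0; rewrite -ler_ln ?posrE ?mulr_gt0 ?powR_gt0 //.
by rewrite lnM ?posrE ?powR_gt0 // !ln_powR.
Qed.

(** Here [u] lies between 0 and [v]. In the geometric mean with [t = u / v] the exponent of [a] is
    [- u], and that of [b] is [w (1 - t) - u = 0] by [w (v - u) = u v]. At [b k = 0] the middle
    weight may be positive while both ends are zero, hence the condition on [Y]. *)
Lemma chain_mid_A : 0 < u / v < 1 -> (forall k, b k = 0 -> forall l, Y k l = 0) ->
  ln (qn u (gramw Y sA)) <= (1 - u / v) * ln (retr (gramw Y sB)) +
    u / v * ln (qn v (gramw Y sAB)).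
Proof.
move=> t01 Yb; apply: ln_le => //.
have := @interp_zero_end R _ _ Y sB sAB sA (u / v) sB0 sAB0 sA0 t01 _ sA_gt0 v v1 vn0.
rewrite divfK //; apply=> k.
have [ak|ak] := eqVneq (a k) 0.
  by right; rewrite /sA ak powR0 ?oppr_eq0 // mulr_ge0 ?powR_ge0.
have [bk|bk] := eqVneq (b k) 0; first by left=> l; exact: Yb.
right; have ap : 0 < a k by rewrite lt0r ak a0.
have bp : 0 < b k by rewrite lt0r bk b0.
rewrite /sA /sAB /sB -!powRrM (powRM _ (a0 k) (b0 k)) !powRE // -!expRD.
apply: eq_ler; congr expR.
rewrite wE; field; by rewrite vu0 vn0.
Qed.

(** Here [v] lies between 0 and [u]. At a zero of [a] or [b] the middle weight itself is 0, so the
    bound holds there for every [Y]. *)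
Lemma chain_mid_AB : 0 < v / u < 1 ->
  ln (qn v (gramw Y sAB)) <= (1 - v / u) * ln (retr (gramw Y sB)) +
    v / u * ln (qn u (gramw Y sA)).
Proof.
move=> t01; apply: ln_le => //.
have := @interp_zero_end R _ _ Y sB sA sAB (v / u) sB0 sA0 sAB0 t01 _ sAB_gt0 u u1 un0.
rewrite divfK //; apply=> k; right.
have [ak|ak] := eqVneq (a k) 0.
  by rewrite /sAB ak mul0r powR0 ?oppr_eq0 // mulr_ge0 ?powR_ge0.
have [bk|bk] := eqVneq (b k) 0.
  by rewrite /sAB bk mulr0 powR0 ?oppr_eq0 // mulr_ge0 ?powR_ge0.
have ap : 0 < a k by rewrite lt0r ak a0.
have bp : 0 < b k by rewrite lt0r bk b0.
rewrite /sA /sAB /sB -!powRrM (powRM _ (a0 k) (b0 k)) !powRE // -!expRD.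
apply: eq_ler; congr expR.
rewrite wE; field; by rewrite vu0 un0.
Qed.

(** Here 0 lies between [u] and [v]; the value of [t] is the one placing the middle at 0, where the
    powers of [a] cancel. *)
Lemma chain_mid_B : u * v < 0 ->
  (forall k, a k = 0 \/ b k = 0 -> forall l, Y k l = 0) ->
  ln (retr (gramw Y sB)) <= v / (v - u) * ln (qn u (gramw Y sA)) -
    u / (v - u) * ln (qn v (gramw Y sAB)).
Proof.
move=> uv0 Y0.
have opt k : (forall l, Y k l = 0) \/ 0 < a k /\ 0 < b k.
  have [ak|ak] := eqVneq (a k) 0; first by left; apply: Y0; left.
  have [bk|bk] := eqVneq (b k) 0; first by left; apply: Y0; right.
  by right; rewrite !lt0r ak bk a0 b0.
(* [interp_zero_mid] wants the negative end first, so the two ends exchange roles according to the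
   sign of [u]. *)
have [up|un] := ltP 0 u.
- have vn : v < 0 by rewrite -(pmulr_rlt0 _ up).
  have uv : 0 < u - v by rewrite subr_gt0 (lt_trans vn).
  have vu : v - u < 0 by rewrite -opprB oppr_lt0.
  have t01 : 0 < - v / (u - v) < 1.
    by rewrite divr_gt0 ?oppr_gt0 // ltr_pdivrMr // mul1r ltrDr.
  have mid : (1 - - v / (u - v)) * v + - v / (u - v) * u = 0.
    by field; rewrite gt_eqF.
  have dom k : (forall l, Y k l = 0) \/
      sB k <= sAB k `^ (1 - - v / (u - v)) * sA k `^ (- v / (u - v)).
    case: (opt k) => [|[ap bp]]; [by left|right].
    rewrite /sA /sAB /sB -!powRrM (powRM _ (a0 k) (b0 k)) !powRE // -!expRD.
    apply: eq_ler; congr expR.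
    by rewrite wE; field; rewrite (gt_eqF uv) vu0.
  have := interp_zero_mid sAB0 sA0 sB0 t01 dom sB_gt0 vn up u1 mid.
  move/ln_le => /(_ sB_gt0 qAB_gt0 qA_gt0).
  move=> h; apply: (le_trans h).
  generalize (ln (qn u (gramw Y sA))) (ln (qn v (gramw Y sAB))) => Q Z.
  by apply: eq_ler; field; rewrite (gt_eqF uv) vu0.
- have un' : u < 0 by rewrite lt_neqAle un0.
  have vp : 0 < v by rewrite -(nmulr_rlt0 _ un').
  have vu : 0 < v - u by rewrite subr_gt0 (lt_trans un').
  have t01 : 0 < - u / (v - u) < 1.
    by rewrite divr_gt0 ?oppr_gt0 // ltr_pdivrMr // mul1r ltrDr.
  have mid : (1 - - u / (v - u)) * u + - u / (v - u) * v = 0.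
    by field.
  have dom k : (forall l, Y k l = 0) \/
      sB k <= sA k `^ (1 - - u / (v - u)) * sAB k `^ (- u / (v - u)).
    case: (opt k) => [|[ap bp]]; [by left|right].
    rewrite /sA /sAB /sB -!powRrM (powRM _ (a0 k) (b0 k)) !powRE // -!expRD.
    apply: eq_ler; congr expR.
    by rewrite wE; field.
  have := interp_zero_mid sA0 sAB0 sB0 t01 dom sB_gt0 un' vp v1 mid.
  move/ln_le => /(_ sB_gt0 qA_gt0 qAB_gt0).
  move=> h; apply: (le_trans h).
  generalize (ln (qn u (gramw Y sA))) (ln (qn v (gramw Y sAB))) => Q Z.
  by apply: eq_ler; field.
Qed.

Let u_v : u / v = 1 - u / w.
Proof. by apply: (canRL (addrK _)); rewrite -mulrDr -uvw mulfV. Qed.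

Let v_u : v / u = 1 + v / w.
Proof. by rewrite uvw mulrDr mulfV. Qed.

Local Notation x := (ln (qn u (gramw Y sA))).
Local Notation y := (ln (qn v (gramw Y sAB))).
Local Notation g := (ln (retr (gramw Y sB))).

(** The signs of [v] and [w] fix that of [u] and tell which point is the middle one: [u] if both are
    positive, 0 if only [v] is, [v] if only [w] is. Both negative would give [u > 0], against
    [1/u = 1/v + 1/w]. Multiplying by the exponent that fits yields the same inequality each
    time. *)
Lemma chain_real_pos : 0 < u * v * w ->
  (0 < v -> forall k, a k = 0 \/ b k = 0 -> forall l, Y k l = 0) ->
  u^-1 * x - v^-1 * y <= w^-1 * g.
Proof.
move=> uvw0; move: chain_mid_A chain_mid_AB chain_mid_B.
generalize x y g => X Z G C1 C2 C3 Y0; have [vp|vn] := ltP 0 v.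
- have [wp|wn] := ltP 0 w.
  + have up : 0 < u by move: uvw0; rewrite pmulr_lgt0 // pmulr_lgt0.
    have t01 : 0 < u / v < 1 by rewrite divr_gt0 //= u_v gtrBl divr_gt0.
    have h := C1 t01 (fun k bk => Y0 vp k (or_intror bk)).
    rewrite -(ler_pM2l up); apply: le_trans (_ : X - u / v * Z <= _).
      by apply: eq_ler; field; rewrite un0 vn0.
    rewrite lerBlDr; apply: (le_trans h); rewrite lerD2r u_v.
    by apply: eq_ler; field; rewrite wn0.
  + have wn' : w < 0 by rewrite lt_neqAle wn0.
    have un : u < 0 by move: uvw0; rewrite nmulr_lgt0 // pmulr_llt0.
    have h := C3 _ (Y0 vp); rewrite pmulr_llt0 // in h.
    rewrite -(ler_nM2l wn'); apply: le_trans (_ : G <= _).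
      by rewrite mulrA mulfV // mul1r.
    apply: (le_trans (h un)).
    by apply: eq_ler; rewrite wE; field; rewrite vu0 un0 vn0.
- have vn' : v < 0 by rewrite lt_neqAle vn0.
  have [wp|wn] := ltP 0 w.
  + have un : u < 0 by move: uvw0; rewrite pmulr_lgt0 // nmulr_lgt0.
    have t01 : 0 < v / u < 1.
      by rewrite nmulr_rgt0 ?invr_lt0 // un /= v_u gtrDl nmulr_rlt0 // invr_gt0.
    have h := C2 t01.
    rewrite lerBlDr -lerBlDl -(ler_nM2l vn'); apply: le_trans (_ : Z <= _).
      by rewrite mulrA mulfV // mul1r.
    apply: (le_trans h); rewrite v_u.
    by apply: eq_ler; rewrite uvw; field; rewrite wn0 vn0.
  + have wn' : w < 0 by rewrite lt_neqAle wn0.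
    have up : 0 < u by move: uvw0; rewrite nmulr_lgt0 // nmulr_llt0.
    have : u^-1 < 0 by rewrite uvw -oppr_gt0 opprD addr_gt0 // oppr_gt0 invr_lt0.
    by rewrite invr_lt0 ltNge (ltW up).
Qed.

(** The mirror case: both positive is impossible, and the middle point is [v] if only [v] is
    positive, 0 if only [w] is, and [u] if both are negative. *)
Lemma chain_real_neg : u * v * w < 0 ->
  (forall k, b k = 0 -> forall l, Y k l = 0) ->
  (0 < u -> forall k, a k = 0 -> forall l, Y k l = 0) ->
  w^-1 * g <= u^-1 * x - v^-1 * y.
Proof.
move=> uvw0; move: chain_mid_A chain_mid_AB chain_mid_B.
generalize x y g => X Z G C1 C2 C3 Yb Ya; have [vp|vn] := ltP 0 v.
- have [wp|wn] := ltP 0 w.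
  + have un : u < 0 by move: uvw0; rewrite pmulr_llt0 // pmulr_llt0.
    have : 0 < u^-1 by rewrite uvw addr_gt0 // invr_gt0.
    by rewrite invr_gt0 ltNge (ltW un).
  + have wn' : w < 0 by rewrite lt_neqAle wn0.
    have up : 0 < u by move: uvw0; rewrite nmulr_llt0 // pmulr_lgt0.
    have t01 : 0 < v / u < 1.
      by rewrite divr_gt0 //= v_u gtrDl pmulr_rlt0 // invr_lt0.
    have h := C2 t01.
    rewrite lerBrDl -lerBrDr -(ler_pM2l vp); apply: le_trans (_ : Z <= _).
      by rewrite mulrA mulfV // mul1r.
    apply: (le_trans h); rewrite v_u.
    by apply: eq_ler; rewrite uvw; field; rewrite wn0 vn0.
- have vn' : v < 0 by rewrite lt_neqAle vn0.
  have [wp|wn] := ltP 0 w.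
  + have up : 0 < u by move: uvw0; rewrite pmulr_llt0 // nmulr_llt0.
    have h := C3 (_ : u * v < 0); rewrite pmulr_rlt0 // in h.
    rewrite -(ler_pM2l wp); apply: le_trans (_ : G <= _).
      by rewrite mulrA mulfV // mul1r.
    apply: (le_trans (h vn' _)); first by move=> k []; [exact: Ya|exact: Yb].
    by apply: eq_ler; rewrite wE; field; rewrite vu0 un0 vn0.
  + have wn' : w < 0 by rewrite lt_neqAle wn0.
    have un : u < 0 by move: uvw0; rewrite nmulr_llt0 // nmulr_lgt0.
    have t01 : 0 < u / v < 1.
      by rewrite nmulr_rgt0 ?invr_lt0 // vn' /= u_v gtrBl nmulr_rgt0 // invr_lt0.
    have h := C1 t01 Yb.
    rewrite -(ler_nM2l un); apply: le_trans (_ : X - u / v * Z <= _).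
      by apply: eq_ler; field; rewrite un0 vn0.
    rewrite lerBlDr; apply: (le_trans h); rewrite lerD2r u_v.
    by apply: eq_ler; field; rewrite wn0.
Qed.

End ChainReal.

(** * Entropies and divergences as logarithms of Schatten norms *)

Section Divergence.
Variable R : realType.
Local Notation C := (R[i]).
Local Notation Re := (@complex.Re R).
Implicit Types alpha beta gamma : R.

(** The reciprocal of the Hoelder conjugate of [alpha]: it makes the condition on the parameters
    additive in reciprocals, and [qn (rprime alpha)] has Schatten exponent [alpha]. *)
Definition rprime alpha := (alpha - 1) / alpha.

Lemma onem_rprime alpha : 0 < alpha -> 1 - rprime alpha = alpha^-1.
Proof. by move=> a0; rewrite /rprime; field; rewrite gt_eqF. Qed.

Lemma rprime_lt1 alpha : 0 < alpha -> rprime alpha < 1.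
Proof. by move=> a0; rewrite -subr_gt0 onem_rprime // invr_gt0. Qed.

Lemma rprime_neq0 alpha : 0 < alpha -> alpha != 1 -> rprime alpha != 0.
Proof. by move=> a0 a1; rewrite mulf_neq0 ?invr_neq0 ?subr_eq0 // gt_eqF. Qed.

Lemma rprime_gt0 alpha : 0 < alpha -> (0 < rprime alpha) = (1 < alpha).
Proof. by move=> a0; rewrite pmulr_lgt0 ?invr_gt0 // subr_gt0. Qed.

Lemma rprimeV alpha : (rprime alpha)^-1 = alpha / (alpha - 1).
Proof. by rewrite invf_div. Qed.

Lemma ln_qn_rprime n alpha (A : 'M[C]_n) : 0 < alpha -> alpha != 1 ->
  (rprime alpha)^-1 * ln (qn (rprime alpha) A) =
  (alpha - 1)^-1 * ln (retr (mpow A alpha)).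
Proof.
move=> a0 a1; rewrite /qn onem_rprime // invrK ln_powR mulrA; congr (_ * _).
by rewrite rprimeV; field; rewrite subr_eq0 a1 gt_eqF.
Qed.

Lemma retr_mpow_gt0 n alpha (A : 'M[C]_n) : psdmx A -> alpha != 0 ->
  0 < retr A -> 0 < retr (mpow A alpha).
Proof.
by move=> /psd_eigdec h a0 A0; rewrite (retr_mpow _ h) (psd_retr_gt0P h).
Qed.

Lemma renyiH_fin n beta (A : 'M[C]_n) : psdmx A -> 0 < retr A -> 0 < beta ->
  beta != 1 ->
  renyiH beta A = (- ((rprime beta)^-1 * ln (qn (rprime beta) A)) / ln 2)%:E.
Proof.
move=> pA A0 b0 b1; rewrite /renyiH /log2e retr_mpow_gt0 ?gt_eqF //.
rewrite -EFinM ln_qn_rprime //; congr EFin.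
by rewrite -(opprB beta 1) invrN mulrA !mulNr.
Qed.

Section Sandwiched.
Variables (n : nat) (X sigma U : 'M[C]_n) (d : 'I_n -> R) (alpha : R).
Hypothesis hs : eigdec sigma U d.
Hypothesis a0 : 0 < alpha.
Hypothesis a1 : alpha != 1.
Let rho := X *m adjmx X.
Let w i := d i `^ (- rprime alpha).

(** With [S] the power of [sigma], [S rho S] is the Gram product of [S X] in one order and
    [X^* S^2 X] the one in the other order; both have the same power traces. The exponent of [S^2]
    is [2 s = - rprime alpha]. *)
Lemma retr_sandwich (s := (1 - alpha) / (2 * alpha)) :
  retr (mpow (mpow sigma s *m rho *m mpow sigma s) alpha) =
  retr (mpow (gramw (U *m X) w) alpha).
Proof.
set S := mpow sigma s.
have SE : S = gramw U (fun i => d i `^ s) by exact: mpow_eigdec.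
have Sh : adjmx S = S.
  by rewrite SE /gramw !adjmxM adjmxK adj_rdiag mulmxA.
clearbody S.
have -> : S *m rho *m S = (S *m X) *m adjmx (S *m X).
  by rewrite adjmxM Sh !mulmxA.
have an0 : alpha != 0 by rewrite gt_eqF.
apply: (etrans (retr_mpow_gramC (S *m X) an0)).
apply: (congr1 (fun A => retr (mpow A alpha))).
rewrite adjmxM Sh SE /gramw adjmxM.
have hU := eigdec_iso hs.
have -> : rdiag w = rdiag (fun i => d i `^ s) *m rdiag (fun i => d i `^ s) :> 'M[C]_n.
  rewrite mul_rdiag; apply: eq_rdiag => i.
  have di := eigdec_ge0 hs i.
  rewrite -powRM // -expr2 -powR_mulrn // -powRrM; congr (_ `^ _).
  by rewrite /rprime /s; field; rewrite gt_eqF.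
by rewrite -!mulmxA (mulmxA U (adjmx U)) hU mul1mx.
Qed.

Lemma sandwiched_fin : (rho^T :&: sigma^T)%MS != 0 ->
  (kermx sigma^T <= kermx rho^T)%MS || (alpha < 1) ->
  sandwiched alpha rho sigma =
    ((rprime alpha)^-1 * ln (qn (rprime alpha) (gramw (U *m X) w)) / ln 2)%:E.
Proof.
move=> hJ hK; rewrite /sandwiched hJ hK /= retr_sandwich /log2e.
have w0 i : 0 <= w i by exact: powR_ge0.
rewrite retr_mpow_gt0 ?gt_eqF //; last 2 first.
- exact: psd_gramw.
- apply: (image_cap_gramw_gt0 hs w0 _ hJ) => i di.
  by rewrite powR_gt0 // lt0r di (eigdec_ge0 hs).
by rewrite -EFinM ln_qn_rprime // mulrA.
Qed.

End Sandwiched.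

Lemma retr_gramw_gt0_ex m n (Y : 'M[C]_(m, n)) s :
  0 < retr (gramw Y s) -> exists k l, s k != 0 /\ Y k l != 0.
Proof.
move=> h; apply: contrapT => hn; move: h; rewrite retr_gramw big1 ?ltxx // => k _.
have [->|sk] := eqVneq (s k) 0; first by rewrite mul0r.
rewrite big1 ?mulr0 // => l _.
have [->|Ykl] := eqVneq (Y k l) 0; first exact: sqn0.
by case: hn; exists k, l.
Qed.

(** * Chain rules for the divergences, including infinite values *)

Section Chain.
Variables (dA dB : nat) (rho : 'M[C]_(dA * dB)) (alpha beta gamma : R).
Hypothesis hrho : density rho.
Hypothesis a0 : 0 < alpha.
Hypothesis a1 : alpha != 1.
Hypothesis b0 : 0 < beta.
Hypothesis b1 : beta != 1.
Hypothesis g0 : 0 < gamma.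
Hypothesis g1 : gamma != 1.
Hypothesis abg : alpha / (alpha - 1) = beta / (beta - 1) + gamma / (gamma - 1).

Local Notation u := (rprime alpha).
Local Notation v := (rprime gamma).
Local Notation w := (rprime beta).

Let uvw : u^-1 = v^-1 + w^-1.
Proof. by rewrite !rprimeV abg addrC. Qed.

Let uvwE : u * v * w = (alpha - 1) * (beta - 1) * (gamma - 1) / (alpha * beta * gamma).
Proof. by rewrite /rprime; field; rewrite !gt_eqF. Qed.

Let rhoB_psd : psdmx (ptrA rho).
Proof. by apply: psd_ptrA; case: hrho. Qed.

Let rhoB_gt0 : 0 < retr (ptrA rho).
Proof. by rewrite retr_ptrA /retr; case: hrho => _ ->; exact: ltr01. Qed.

Let gt1 (x : R) : x != 1 -> ~~ (x < 1) -> 1 < x.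
Proof. by move=> x1; rewrite -leNgt lt_neqAle eq_sym x1. Qed.

Section Decomposed.
Variables (X : 'M[C]_(dA * dB)) (sA UA : 'M[C]_dA) (sB UB : 'M[C]_dB).
Variables (a : 'I_dA -> R) (b : 'I_dB -> R).
Hypothesis rhoE : rho = X *m adjmx X.
Hypothesis hA : eigdec sA UA a.
Hypothesis hB : eigdec sB UB b.
Let Y := (UA *t UB) *m X.
Let aa (k : 'I_(dA * dB)) := a (mxtens_unindex k).1.
Let bb (k : 'I_(dA * dB)) := b (mxtens_unindex k).2.
Let hAB : eigdec (sA *t sB) (UA *t UB) (fun k => aa k * bb k).
Proof. exact: eigdec_tens. Qed.
Let hA1 : eigdec (sA *t 1%:M) (UA *t UB) aa.
Proof.
have [hU d0 ->] := eigdec_tens hA (eigdec1 (eigdec_iso hB)).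
split; [exact: hU | by move=> k; exact: (eigdec_ge0 hA) |].
by congr (_ *m _ *m _); apply: eq_rdiag => k; rewrite mulr1.
Qed.

Let aa0 k : 0 <= aa k. Proof. exact: (eigdec_ge0 hA). Qed.
Let bb0 k : 0 <= bb k. Proof. exact: (eigdec_ge0 hB). Qed.

Let JAB := ((X *m adjmx X)^T :&: (sA *t sB)^T)%MS != 0.
Let JA1 := ((X *m adjmx X)^T :&: (sA *t 1%:M)^T)%MS != 0.

Let nzP : JAB -> exists k l, [/\ aa k != 0, bb k != 0 & Y k l != 0].
Proof.
move=> hJ; have s0 k : 0 <= aa k * bb k by rewrite mulr_ge0.
have sp k : aa k * bb k != 0 -> 0 < aa k * bb k by move=> h; rewrite lt0r h s0.
have /retr_gramw_gt0_ex[k [l [sk ykl]]] := image_cap_gramw_gt0 hAB s0 sp hJ.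
exists k, l; split=> //; first by apply: contra_neq sk => ->; rewrite mul0r.
by apply: contra_neq sk => ->; rewrite mulr0.
Qed.

Let lnB : retr (gramw Y (fun k => bb k `^ w)) =
  \sum_j b j `^ w * dg UB (ptrA rho) j.
Proof. by rewrite rhoE; exact: (retr_gramw_snd X UB (eigdec_iso hA) (fun j => b j `^ w)). Qed.

(** If the right-hand side is finite, its support conditions pass to [sA *t 1%:M]. Then
    [chain_real_pos] applies, and the variational formula replaces the trace of [rho_B sB^w] by
    [qn w (ptrA rho)]. *)
Lemma sandwiched_chain_ge : \sum_j b j = 1 ->
  0 < (alpha - 1) * (beta - 1) * (gamma - 1) ->
  (renyiH beta (ptrA rho) + sandwiched alpha rho (sA *t 1%:M)
    <= sandwiched gamma rho (sA *t sB))%E.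
Proof.
move=> sb1 sgn.
have uvw0 : 0 < u * v * w by rewrite uvwE divr_gt0 // !mulr_gt0.
have [hc|/negbTE hc] := boolP (((rho^T :&: (sA *t sB)^T)%MS != 0) &&
   ((kermx (sA *t sB)^T <= kermx rho^T)%MS || (gamma < 1))); last first.
  by rewrite [X in (_ <= X)%E]/sandwiched hc leey.
move: hc => /andP[hJ hK]; rewrite rhoE in hJ hK.
have Y0 : 0 < v -> forall k, aa k = 0 \/ bb k = 0 -> forall l, Y k l = 0.
  rewrite rprime_gt0 // => gg k hk; move: hK; rewrite ltNge (ltW gg) orbF.
  by move/(ker_subP X hAB) => h; apply: h; case: hk => ->; rewrite ?mul0r ?mulr0.
(* [sA *t 1%:M] has fewer zero eigenvalues in the common basis, so the same vector still lies in its
   image. *)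
have hJ1 : JA1.
  apply/(image_capP X hA1); have [x [x0 hx]] := image_capP X hAB hJ.
  by exists x; split=> // k ak; apply: hx; rewrite ak mul0r.
(* If [alpha > 1] then [u > 0], and the sign condition forces [v > 0]; the kernel inclusion known
   for [gamma > 1] then takes over. *)
have hK1 : (kermx (sA *t 1%:M)^T <= kermx (X *m adjmx X)^T)%MS || (alpha < 1).
  have [//|/(gt1 a1) aa1] := boolP (alpha < 1); first by rewrite orbT.
  rewrite orbF; apply/(ker_subP X hA1) => k ak l.
  apply: Y0; last by left.
  have up : 0 < u by rewrite rprime_gt0.
  have [//|vn] := ltP 0 v; exfalso.
  have vn' : v < 0 by rewrite lt_neqAle rprime_neq0.
  have wn : w < 0 by move: uvw0; rewrite nmulr_rgt0 // pmulr_rlt0.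
  have : 0 < v^-1 + w^-1 by rewrite -uvw invr_gt0.
  by rewrite ltNge ltW // -oppr_gt0 opprD addr_gt0 // oppr_gt0 invr_lt0.
have SA := sandwiched_fin hA1 a0 a1 hJ1 hK1.
have SB := sandwiched_fin hAB g0 g1 hJ hK.
have un0 := rprime_neq0 a0 a1; have vn0 := rprime_neq0 g0 g1.
have wn0 := rprime_neq0 b0 b1; have nz := nzP hJ.
have main := chain_real_pos aa0 bb0 un0 vn0 wn0 uvw (rprime_lt1 a0) (rprime_lt1 g0) nz uvw0 Y0.
have bdg j : b j = 0 -> 0 < v -> dg UB (ptrA rho) j = 0.
  move=> bj vp; rewrite rhoE (dg_ptrA X UB (eigdec_iso hA)).
  rewrite big1 // => i _; rewrite big1 // => k _; rewrite -/Y.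
  by rewrite (Y0 vp) ?sqn0 //; right; rewrite /bb mxtens_indexK.
have qB := qn_gt0 rhoB_psd (rprime_lt1 b0) rhoB_gt0.
have gB : w^-1 * ln (retr (gramw Y (fun k => bb k `^ w))) <=
    w^-1 * ln (qn w (ptrA rho)).
  have [wp|wn] := ltP 0 w.
    rewrite ler_pM2l ?invr_gt0 // ler_ln ?posrE //; last first.
      apply: (gramw_gt0 nz) => [k|k _ bk]; first exact: powR_ge0.
      by rewrite powR_eq0 negb_and bk.
    rewrite lnB; apply: (qn_sup rhoB_psd (eigdec_iso hB) (eigdec_ge0 hB) sb1).
    by rewrite wp rprime_lt1.
  have wn' : w < 0 by rewrite lt_neqAle wn0.
  (* For negative [w] the variational bound is a minimum and needs a support condition, which is
     available once [v > 0]. *)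
  have vp : 0 < v.
    have [//|vn] := ltP 0 v; exfalso.
    have vn' : v < 0 by rewrite lt_neqAle vn0.
    have up : 0 < u by move: uvw0; rewrite nmulr_lgt0 // nmulr_llt0.
    have : 0 < v^-1 + w^-1 by rewrite -uvw invr_gt0.
    by rewrite ltNge ltW // -oppr_gt0 opprD addr_gt0 // oppr_gt0 invr_lt0.
  have le_q : qn w (ptrA rho) <= retr (gramw Y (fun k => bb k `^ w)).
    rewrite lnB; apply: (qn_inf rhoB_psd (eigdec_iso hB) (eigdec_ge0 hB) sb1 wn').
    by move=> j bj; exact: bdg.
  rewrite ler_nM2l ?invr_lt0 // ler_ln ?posrE //.
  exact: lt_le_trans le_q.
rewrite -rhoE in SA SB.
rewrite SA SB (renyiH_fin rhoB_psd rhoB_gt0 b0 b1) -EFinD lee_fin -mulrDl.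
rewrite ler_pM2r ?invr_gt0 ?ln_gt0 ?ltr1n //.
have {}main := le_trans main gB.
by rewrite addrC lerBlDr -lerBlDl.
Qed.

(** The two conditions on [b] say that [sB] attains the variational formula for the marginal, so the
    bound of [chain_real_neg] is already in terms of [qn w (ptrA rho)]. *)
Lemma sandwiched_chain_le :
  (forall j, b j = 0 -> dg UB (ptrA rho) j = 0) ->
  \sum_j b j `^ w * dg UB (ptrA rho) j = qn w (ptrA rho) ->
  (alpha - 1) * (beta - 1) * (gamma - 1) < 0 ->
  (sandwiched gamma rho (sA *t sB) <=
   renyiH beta (ptrA rho) + sandwiched alpha rho (sA *t 1%:M))%E.
Proof.
move=> bdg bopt sgn.
have uvw0 : u * v * w < 0 by rewrite uvwE pmulr_llt0 // invr_gt0 !mulr_gt0.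
have [hc|/negbTE hc] := boolP (((rho^T :&: (sA *t 1%:M)^T)%MS != 0) &&
   ((kermx (sA *t 1%:M)^T <= kermx rho^T)%MS || (alpha < 1))); last first.
  rewrite [in X in (_ <= X)%E]/sandwiched hc (renyiH_fin rhoB_psd rhoB_gt0 b0 b1).
  by rewrite addey ?leey.
move: hc => /andP[hJ hK]; rewrite rhoE in hJ hK.
have Yb k : bb k = 0 -> forall l, Y k l = 0.
  rewrite -(mxtens_unindexK k); case: (mxtens_unindex k) => i j.
  rewrite /bb mxtens_indexK => /bdg; rewrite rhoE => h l.
  exact: (dg_ptrA_eq0 (eigdec_iso hA) h).
have Ya : 0 < u -> forall k, aa k = 0 -> forall l, Y k l = 0.
  rewrite rprime_gt0 // => gg; move: hK; rewrite ltNge (ltW gg) orbF.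
  by move/(ker_subP X hA1).
(* [Y] has no rows where [b] is zero, so tensoring with [sB] in place of the identity imposes
   nothing new on [rho *m x]. *)
have hJ1 : JAB.
  apply/(image_capP X hAB); have [x [x0 hx]] := image_capP X hA1 hJ.
  exists x; split=> // k /eqP; rewrite mulf_eq0 => /orP[/eqP/hx //|/eqP/Yb Yk].
  by rewrite !mulmxA -/Y -mulmxA mxE big1 // => l _; rewrite Yk mul0r.
have hK1 : (kermx (sA *t sB)^T <= kermx (X *m adjmx X)^T)%MS || (gamma < 1).
  have [//|/(gt1 g1) gg] := boolP (gamma < 1); first by rewrite orbT.
  have vp : 0 < v by rewrite rprime_gt0.
  (* Otherwise [u < 0 < v] would force [w > 0], making [1/u = 1/v + 1/w] positive. *)
  have up : 0 < u.
    have [//|un] := ltP 0 u; exfalso.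
    have un' : u < 0 by rewrite lt_neqAle rprime_neq0.
    have wp : 0 < w by move: uvw0; rewrite nmulr_rlt0 // nmulr_rlt0.
    have : v^-1 + w^-1 < 0 by rewrite -uvw invr_lt0.
    by rewrite ltNge ltW // addr_gt0 // invr_gt0.
  rewrite orbF; apply/(ker_subP X hAB) => k /eqP.
  by rewrite mulf_eq0 => /orP[/eqP|/eqP]; [exact: Ya | exact: Yb].
have SA := sandwiched_fin hA1 a0 a1 hJ hK.
have SB := sandwiched_fin hAB g0 g1 hJ1 hK1.
have un0 := rprime_neq0 a0 a1; have vn0 := rprime_neq0 g0 g1.
have wn0 := rprime_neq0 b0 b1; have nz := nzP hJ1.
have main := chain_real_neg aa0 bb0 un0 vn0 wn0 uvw (rprime_lt1 a0) (rprime_lt1 g0) nz uvw0 Yb Ya.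
rewrite lnB bopt in main.
rewrite -rhoE in SA SB.
rewrite SA SB (renyiH_fin rhoB_psd rhoB_gt0 b0 b1) -EFinD lee_fin -mulrDl.
rewrite ler_pM2r ?invr_gt0 ?ln_gt0 ?ltr1n //.
by rewrite addrC lerBrDr -lerBrDl.
Qed.

End Decomposed.

Lemma sandwiched_tens_ge (sA : 'M[C]_dA) (sB : 'M[C]_dB) :
  psdmx sA -> density sB ->
  0 < (alpha - 1) * (beta - 1) * (gamma - 1) ->
  (renyiH beta (ptrA rho) + sandwiched alpha rho (sA *t 1%:M)
    <= sandwiched gamma rho (sA *t sB))%E.
Proof.
move=> /psd_eigdec hA [/psd_eigdec hB trB] sgn.
have [X rhoE] := psd_factor hrho.1.
apply: (sandwiched_chain_ge rhoE hA hB _ sgn).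
by rewrite -(retr_eigdec hB) /retr trB.
Qed.

(** The state [sB] is the optimizer for the marginal, proportional to its power [1/(1-w) = beta]. It
    does not depend on [sA], so one choice serves both upper bounds. *)
Lemma sandwiched_tens_le :
  (alpha - 1) * (beta - 1) * (gamma - 1) < 0 ->
  exists2 sB : 'M[C]_dB, density sB & forall sA : 'M[C]_dA, psdmx sA ->
  (sandwiched gamma rho (sA *t sB) <=
   renyiH beta (ptrA rho) + sandwiched alpha rho (sA *t 1%:M))%E.
Proof.
move=> sgn.
have [H [o [hH o0 o1 supp opt]]] := qn_opt rhoB_psd rhoB_gt0 (rprime_lt1 b0).
have hB : eigdec (gramw H o) H o by split.
exists (gramw H o).
  split; first exact: psd_gramw.
  rewrite /gramw mxtrace_mulC mulmxA hH mul1mx mxtrace_rdiag o1.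
  by rewrite rmorph1.
move=> sA /psd_eigdec hA; have [X rhoE] := psd_factor hrho.1.
exact: (sandwiched_chain_le rhoE hA hB supp (esym opt) sgn).
Qed.

End Chain.
End Divergence.

Theorem theorem1 (R : realType) (dA dB : nat) (rho : 'M[R[i]]_(dA * dB))
  (alpha beta gamma : R) :
  density rho ->
  0 < alpha -> alpha != 1 ->
  1 / 2 <= beta -> beta != 1 ->
  1 / 2 <= gamma -> gamma != 1 ->
  alpha / (alpha - 1) = beta / (beta - 1) + gamma / (gamma - 1) ->
  (0 < (alpha - 1) * (beta - 1) * (gamma - 1) ->
     (renyiH beta (ptrA rho) - Hdown alpha rho <= Iup gamma rho)%E /\
     (renyiH beta (ptrA rho) - Hup alpha rho <= Idown gamma rho)%E) /\
  ((alpha - 1) * (beta - 1) * (gamma - 1) < 0 ->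
     (Iup gamma rho <= renyiH beta (ptrA rho) - Hdown alpha rho)%E /\
     (Idown gamma rho <= renyiH beta (ptrA rho) - Hup alpha rho)%E).
Proof.
move=> hrho a0 a1 hb b1 hg g1 abg.
have half : 0 < 1 / 2 :> R by lra.
have b0 := lt_le_trans half hb; have g0 := lt_le_trans half hg.
have rhoA_psd := psd_ptrB hrho.1.
rewrite /Hdown /Hup !oppeK; split=> sgn.
(* The lower bounds hold for every pair of states: [sA] is the marginal for [Iup], and runs over all
   states for [Idown]. *)
- have ge := fun sA sB => sandwiched_tens_ge (sA := sA) (sB := sB) hrho a0 a1 b0 b1 g0 g1 abg.
  split; apply/ereal_infP => y.
  + by move=> [sB hB <-]; exact: ge.
  + move=> [[sA sB] [/= hA hB] <-]; apply: le_trans (ge _ _ hA.1 hB sgn).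
    by apply: leeD2l; apply: ge_ereal_inf; eexists; [exists sA|].
- have [sB hB le] := sandwiched_tens_le hrho a0 a1 b0 b1 g0 g1 abg sgn.
  (* Finiteness of the entropy allows moving it across the inequality, so that the infimum over [sA]
     can be taken. *)
  have hfin : renyiH beta (ptrA rho) \is a fin_num.
    rewrite renyiH_fin //; first exact: psd_ptrA hrho.1.
    by rewrite retr_ptrA /retr hrho.2; exact: ltr01.
  split.
  + apply: le_trans (le _ rhoA_psd); apply: ge_ereal_inf.
    by eexists; [exists sB|].
  + rewrite -leeBlDl //; apply/ereal_infP => y [sA hA <-].
    rewrite leeBlDl //; apply: le_trans (le _ hA.1); apply: ge_ereal_inf.
    by eexists; [exists (sA, sB)|].
Qed.
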